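(* Let $G$ be a c-regular discrete abelian cyclically ordered group which is not c-archimedean. Then $G$ contains a discrete c-regular pure subgroup $H$ such that $K(H)=\mathbb{U}$ and $l(H)\simeq\mathbb{Z}$, and which is an elementary substructure of $G$ (in the language of cyclically ordered groups).
   Context: All groups are abelian, written additively except subgroups of $\mathbb{K}$. A cyclically ordered group $(G,R)$ is an abelian group $G$ with a ternary relation $R$ such that: $R(a,b,c)$ implies that $a,b,c$ are pairwise distinct; $R(a,b,c)\Rightarrow R(b,c,a)$; for every $c\in G$, $R(c,\cdot,\cdot)$ is a strict linear order on $G\setminus\{c\}$; $R(a,b,c)\Rightarrow R(a+u,b+u,c+u)$. Subgroups carry the restricted relation. The language of cyclically ordered groups is the language of groups together with $R$. $G$ is discrete if it is trivial or $G\setminus\{0\}$ has a smallest element for the order $R(0,\cdot,\cdot)$. $\mathbb{K}$ is the group of complex numbers of modulus $1$, cyclically ordered by: for $0\le\theta_1,\theta_2,\theta_3<2\pi$, $R(e^{i\theta_1},e^{i\theta_2},e^{i\theta_3})$ iff $\theta_1<\theta_2<\theta_3$ up to cyclic permutation of the indices. $\mathbb{U}\subset\mathbb{K}$ is the subgroup of all roots of unity in $\mathbb{C}$. The unwound of $(G,R)$ is the linearly ordered group $\mathrm{uw}(G)$ with underlying set $\mathbb{Z}\times G$, where $(n,c)<(n',c')$ iff $n<n'$, or $n=n'$ and $R(0,c,c')$, or $n=n'$ and $c=0\ne c'$; the addition is $(m,a)+(n,b)=(m+n,a+b)$ if $a=0$ or $b=0$ or $R(0,a,a+b)$, and $(m+n+1,a+b)$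 if $R(0,a+b,a)$ or $a+b=0\neq a$. Put $z_G=(1,0)$; it is positive and cofinal, and $G\simeq\mathrm{uw}(G)/\langle z_G\rangle$. Let $C$ be the greatest proper convex subgroup of $\mathrm{uw}(G)$. The linear part $l(G)$ is the image of $C$ in $G$ (an isomorphic copy of $C$), with the linear order inherited from $\mathrm{uw}(G)$. $K(G)=G/l(G)$ is cyclically ordered by: for $a,b,c$ in pairwise distinct classes, $R(\bar a,\bar b,\bar c)$ iff $R(a,b,c)$. $K(G)$ embeds, as a cyclically ordered group, in $\mathbb{K}$, and is identified with its image. $G$ is c-archimedean if $l(G)=\{0\}$ (equivalently $G$ is isomorphic to a subgroup of $\mathbb{K}$). $R(x_1,\dots,x_m)$ (with $m\ge3$) means that $R(x_i,x_j,x_k)$ holds for all $1\le i<j<k\le m$. For $n\ge2$, $(G,R)$ is c-$n$-regular if for all $x_1,\dots,x_n\in G$ with $R(0,x_1,\dots,x_n)$ there is $x\in G$ such that ($nx=x_1$ or $nx=x_n$ or $R(x_1,nx,x_n)$) and $R(0,x,\dots,(n-1)x,x_n)$. $G$ is c-regular if it is c-$n$-regular for every $n\ge2$. *)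

(* Defs.v *)
From HB Require Import structures.
From mathcomp Require Import all_boot all_order all_algebra.
From mathcomp Require Import ring_quotient generic_quotient complex.
From mathcomp Require Import all_classical all_reals all_analysis.
From mathcomp Require Import zify.

Set Implicit Arguments.
Unset Strict Implicit.
Unset Printing Implicit Defensive.

Import Order.TTheory GRing.Theory Num.Theory.

Local Open Scope classical_set_scope.
Local Open Scope quotient_scope.
Local Open Scope ring_scope.

(* [cyc a b c] is R(a, b, c); [cyc_trans] and [cyc_total], with the
   distinctness axiom [cyc_neq], say that [cyc c] is a strict linear order on
   the complement of [c]. *)
HB.mixin Record isCyclicallyOrdered G of GRing.Zmodule G := {
  cyc : G -> G -> G -> bool;
  cyc_neq : forall a b c, cyc a b c -> [/\ a != b, b != c & a != c];
  cyc_rot : forall a b c, cyc a b c -> cyc b c a;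
  cyc_trans : forall c x y z, cyc c x y -> cyc c y z -> cyc c x z;
  cyc_total : forall c x y,
    x != c -> y != c -> x != y -> cyc c x y || cyc c y x;
  cyc_add : forall u a b c, cyc a b c -> cyc (a + u) (b + u) (c + u)
}.

#[short(type="cogroupType")]
HB.structure Definition COGroup :=
  {G of isCyclicallyOrdered G & GRing.Zmodule G}.

Arguments cyc_neq {_ _ _ _}.
Arguments cyc_rot {_ _ _ _}.
Arguments cyc_trans {_ _ _ _ _}.
Arguments cyc_total {_ _ _ _}.
Arguments cyc_add {_} u {_ _ _}.

Section Subgroup.
Variables (G : cogroupType) (H : zmodClosed G).

Record subco := SubCO { subco_val :> G; _ : subco_val \in H }.

HB.instance Definition _ := [isSub for subco_val].
HB.instance Definition _ := [Choice of subco by <:].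
HB.instance Definition _ := [SubChoice_isSubZmodule of subco by <:].

Definition subco_cyc (a b c : subco) := cyc (val a) (val b) (val c).

Fact subco_cyc_neq a b c : subco_cyc a b c -> [/\ a != b, b != c & a != c].
Proof. by move/cyc_neq; rewrite !(inj_eq val_inj). Qed.

Fact subco_cyc_rot a b c : subco_cyc a b c -> subco_cyc b c a.
Proof. exact: cyc_rot. Qed.

Fact subco_cyc_trans c x y z :
  subco_cyc c x y -> subco_cyc c y z -> subco_cyc c x z.
Proof. exact: cyc_trans. Qed.

Fact subco_cyc_total c x y : x != c -> y != c -> x != y ->
  subco_cyc c x y || subco_cyc c y x.
Proof. by rewrite -!(inj_eq val_inj); apply: cyc_total. Qed.

Fact subco_cyc_add u a b c :
  subco_cyc a b c -> subco_cyc (a + u) (b + u) (c + u).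
Proof. exact: cyc_add. Qed.

HB.instance Definition _ := isCyclicallyOrdered.Build subco subco_cyc_neq
  subco_cyc_rot subco_cyc_trans subco_cyc_total subco_cyc_add.

End Subgroup.

Section Notions.
Variable G : cogroupType.

Definition discrete_co : Prop :=
  (forall x : G, x = 0) \/
  exists2 e : G, e != 0 & forall x : G, x != 0 -> x = e \/ cyc 0 e x.

Definition pure_subgroup (H : zmodClosed G) : Prop :=
  forall (n : nat) (h : G), (0 < n)%N -> h \in H ->
    (exists g : G, g *+ n = h) -> exists2 g : G, g \in H & g *+ n = h.

Definition cyc_seq (s : seq G) : Prop :=
  forall i j k, (i < j < k)%N -> (k < size s)%N -> cyc s`_i s`_j s`_k.

(* Only the values x 1, ..., x n of the sequence x matter. *)
Definition c_n_regular (n : nat) : Prop :=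
  forall x : nat -> G,
    cyc_seq (0 :: [seq x i | i <- iota 1 n]) ->
    exists2 y : G,
      [\/ y *+ n = x 1, y *+ n = x n | cyc (x 1) (y *+ n) (x n)] &
      cyc_seq (rcons [seq y *+ i | i <- iota 0 n] (x n)).

Definition c_regular : Prop := forall n, (1 < n)%N -> c_n_regular n.

End Notions.

Arguments discrete_co : clear implicits.
Arguments c_n_regular : clear implicits.
Arguments c_regular : clear implicits.

Section Unwound.
Variable G : cogroupType.
Implicit Types a b c : G.

Record unwound := Unwound { uw_turn : int; uw_pt : G }.

Definition uw_pair x := (uw_turn x, uw_pt x).
Definition uw_of_pair p := Unwound p.1 p.2.
Fact uw_pairK : cancel uw_pair uw_of_pair. Proof. by case. Qed.

HB.instance Definition _ := Choice.copy unwound (can_type uw_pairK).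

Definition uw_lt (x y : unwound) : bool :=
  (uw_turn x < uw_turn y) ||
  (uw_turn x == uw_turn y) &&
  (cyc 0 (uw_pt x) (uw_pt y) || (uw_pt x == 0) && (uw_pt y != 0)).

Definition uw_zero := Unwound 0 0.

Definition uw_add (x y : unwound) : unwound :=
  let: Unwound m a := x in let: Unwound n b := y in
  if [|| a == 0, b == 0 | cyc 0 a (a + b)] then Unwound (m + n) (a + b)
  else Unwound (m + n + 1) (a + b).

Definition uw_opp (x : unwound) : unwound :=
  let: Unwound m a := x in
  if a == 0 then Unwound (- m) 0 else Unwound (- m - 1) (- a).

(* The strict order on G with least element 0 and, elsewhere, R(0, _, _). *)
Definition clt0 (a b : G) : bool := cyc 0 a b || (a == 0) && (b != 0).

Lemma cyc_asym (a b c : G) : cyc a b c -> cyc a c b = false.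
Proof.
by move=> h; apply/negP => /(cyc_trans h) /cyc_neq[_ /eqP].
Qed.

Lemma clt0_irr a : clt0 a a = false.
Proof.
rewrite /clt0 andbN orbF; apply/negP => /cyc_neq[_ /eqP]; by [].
Qed.

Lemma clt0_trans b a c : clt0 a b -> clt0 b c -> clt0 a c.
Proof.
rewrite /clt0 => /orP[h1|/andP[/eqP-> b0]].
  case/orP=> [h2|/andP[b0 _]]; first by rewrite (cyc_trans h1 h2).
  by case: (cyc_neq h1) => _ _; rewrite eq_sym b0.
case/orP=> [/cyc_neq[_ _ ]|/andP[/eqP b0' _]]; last by rewrite b0' eqxx in b0.
by rewrite eqxx eq_sym => ->; rewrite orbT.
Qed.

Lemma clt0_total a b : a != b -> clt0 a b || clt0 b a.
Proof.
rewrite /clt0 => ab.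
have [a0|a0] := eqVneq a 0; first by rewrite -a0 eq_sym ab orbT.
have [b0|b0] := eqVneq b 0; first by rewrite !orbT.
by rewrite !orbF; apply: cyc_total.
Qed.

Lemma clt0x0 a : clt0 a 0 = false.
Proof.
by rewrite /clt0 eqxx andbF orbF; apply/negP => /cyc_neq[_ _ /eqP].
Qed.

(* [wind x y z] is 1 when going x -> y -> z passes 0 once more than x -> z. *)
Definition wind (x y z : G) : int :=
  (clt0 y x)%:Z + (clt0 z y)%:Z - (clt0 z x)%:Z.

Lemma clt0_asym a b : clt0 a b -> clt0 b a = false.
Proof. by move=> h; apply/negP => /(clt0_trans h); rewrite clt0_irr. Qed.

Lemma clt0_cyc x y z : clt0 x y -> clt0 y z -> cyc x y z.
Proof.
move=> xy yz; move: (xy) (yz); rewrite {1 2}/clt0.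
case/orP=> [h1|/andP[/eqP x0 y0]]; last first.
  by case/orP=> [|/andP[/eqP y0']]; [rewrite x0|rewrite y0' eqxx in y0].
case/orP=> [h2|/andP[/eqP y0]]; last first.
  by move: h1; rewrite y0 => /cyc_neq[_ _ /eqP].
have [/eqP x0 xy' y0] := cyc_neq h1; have [_ yz' z0] := cyc_neq h2.
have h3 := cyc_trans h1 h2.
have [_ xz _] := cyc_neq h3.
have /orP[//|h] : cyc x y z || cyc x z y.
  by apply: cyc_total; rewrite // eq_sym.
have hy : cyc y 0 x by do 2!apply: cyc_rot.
have := cyc_trans (cyc_rot h2) hy.
by rewrite cyc_asym //; do 2!apply: cyc_rot.
Qed.

Lemma windE x y z :
  wind x y z = (~~ [|| x == y, y == z | cyc x y z])%:Z.
Proof.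
rewrite /wind.
have [<-|xy] := eqVneq x y; first by rewrite clt0_irr /=; lia.
have [<-|yz] := eqVneq y z; first by rewrite clt0_irr /=; lia.
have [<-|xz] := eqVneq x z.
  rewrite clt0_irr /=; have -> : cyc x y x = false.
    by apply/negP => /cyc_neq[_ _ /eqP].
  case/orP: (clt0_total xy) => h; rewrite h (clt0_asym h) //.
rewrite /=.
have rot (a b c : G) : cyc a b c -> cyc c a b by move=> h; do 2!apply: cyc_rot.
have rotN (a b c : G) : cyc a c b -> cyc a b c = false by exact: cyc_asym.
case/orP: (clt0_total xy) => h1; case/orP: (clt0_total yz) => h2;
  case/orP: (clt0_total xz) => h3;
  rewrite ?h1 ?h2 ?h3 ?(clt0_asym h1) ?(clt0_asym h2) ?(clt0_asym h3) /=.
- by rewrite (clt0_cyc h1 h2).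
- by have := clt0_trans h1 h2; rewrite (clt0_asym h3).
- by rewrite rotN ?(clt0_cyc h3 h2).
- by rewrite (cyc_rot (clt0_cyc h3 h1)).
- by rewrite rotN ?(cyc_rot (clt0_cyc h1 h3)).
- by rewrite (rot _ _ _ (clt0_cyc h2 h3)).
- by have := clt0_trans h2 h1; rewrite (clt0_asym h3).
- by rewrite rotN // (rot _ _ _ (clt0_cyc h2 h1)).
Qed.

Lemma cyc_addE (u a b c : G) : cyc (a + u) (b + u) (c + u) = cyc a b c.
Proof.
apply/idP/idP => [/(cyc_add (- u))|/(cyc_add u)//].
by rewrite !addrK.
Qed.

Lemma wind_add u x y z : wind (x + u) (y + u) (z + u) = wind x y z.
Proof. by rewrite !windE cyc_addE !(inj_eq (addIr u)). Qed.

Definition carry (a b : G) : int := (clt0 (a + b) a)%:Z.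

Lemma carryE a b : carry a b = wind 0 a (a + b).
Proof. by rewrite /wind !clt0x0 /carry; lia. Qed.

Lemma carryA a b c : carry a b + carry (a + b) c = carry b c + carry a (b + c).
Proof.
have -> : carry b c = wind a (a + b) (a + b + c).
  by rewrite carryE -(wind_add a 0) add0r ![_ + a]addrC addrA.
rewrite !carryE; have -> : a + (b + c) = a + b + c by exact: addrA.
by rewrite /wind; lia.
Qed.

Lemma carry01 a b : carry a b = 0 \/ carry a b = 1.
Proof. by rewrite /carry; case: clt0; [right|left]. Qed.

(* (a, b) |-> carry a b - carry b a is biadditive and bounded, hence zero. *)
Lemma carryC a b : carry a b = carry b a.
Proof.
have := carryA a a b; have := carryA a b a; have := carryA b a a.
have -> : b + a = a + b by exact: addrC.
have := carry01 a b; have := carry01 b a.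
have := carry01 (a + a) b; have := carry01 b (a + a).
lia.
Qed.

(* The two clauses of the addition of the unwound are complementary. *)
Lemma uw_add_clauses (a b : G) :
  ~~ [|| a == 0, b == 0 | cyc 0 a (a + b)] =
  cyc 0 (a + b) a || (a + b == 0) && (a != 0).
Proof.
have := carryE a b; rewrite windE /carry [0 == a]eq_sym.
have -> : (a == a + b) = (b == 0).
  by rewrite -[X in X == _]addr0 (inj_eq (addrI a)) eq_sym.
by rewrite -/(clt0 (a + b) a); case: clt0; case: (~~ _).
Qed.

Lemma uw_addE m a n b :
  uw_add (Unwound m a) (Unwound n b) = Unwound (m + n + carry a b) (a + b).
Proof.
rewrite /carry /clt0 -uw_add_clauses /uw_add.
by case: ifP => _; rewrite ?addr0.
Qed.

Fact uw_addA : associative uw_add.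
Proof.
move=> [m a] [n b] [p c]; rewrite !uw_addE.
congr Unwound; last exact: addrA.
by have := carryA a b c; lia.
Qed.

Fact uw_addC : commutative uw_add.
Proof.
move=> [m a] [n b]; rewrite !uw_addE carryC.
by congr Unwound; [lia|exact: addrC].
Qed.

Fact uw_add0 : left_id uw_zero uw_add.
Proof.
by move=> [m a]; rewrite uw_addE /carry clt0x0 !add0r addr0.
Qed.

Fact uw_addN : left_inverse uw_zero uw_opp uw_add.
Proof.
move=> [m a]; rewrite uw_addC /uw_opp; case: eqVneq => [->|a0].
  by rewrite uw_addE /carry clt0x0 subrr addr0 addr0.
rewrite uw_addE /carry subrr /clt0 eqxx a0 orbT.
by congr Unwound; lia.
Qed.

HB.instance Definition _ :=
  GRing.isZmodule.Build unwound uw_addA uw_addC uw_add0 uw_addN.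

Definition uw_z : unwound := Unwound 1 0.

Lemma uw_ltE m a n b :
  uw_lt (Unwound m a) (Unwound n b) = (m < n) || (m == n) && clt0 a b.
Proof. by []. Qed.

Lemma uw_lt_irr x : uw_lt x x = false.
Proof. by case: x => m a; rewrite uw_ltE ltxx clt0_irr andbF. Qed.

Implicit Types x y z u : unwound.

Lemma uw_lt_trans y x z : uw_lt x y -> uw_lt y z -> uw_lt x z.
Proof.
case: x y z => [m a] [n b] [p c]; rewrite !uw_ltE.
case/orP=> [mn|/andP[/eqP-> ab]]; case/orP=> [np|/andP[/eqP<- bc]].
- by rewrite (lt_trans mn np).
- by rewrite mn.
- by rewrite np.
- by rewrite eqxx (clt0_trans ab bc) orbT.
Qed.

Lemma uw_lt_total x y : x != y -> uw_lt x y || uw_lt y x.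
Proof.
case: x y => [m a] [n b]; rewrite !uw_ltE => xy.
have [//|//|mn] := ltgtP m n.
rewrite /=; apply: clt0_total; apply: contraNneq xy => ab.
by rewrite mn ab.
Qed.

Lemma uw_addUE m a n b :
  Unwound m a + Unwound n b = Unwound (m + n + carry a b) (a + b).
Proof. exact: uw_addE. Qed.

Lemma uw_lt_add u x y : uw_lt x y -> uw_lt (x + u) (y + u).
Proof.
case: u x y => [k u] [m a] [n b]; rewrite !uw_addUE !uw_ltE.
have := wind_add u 0 a b; rewrite add0r /wind !clt0x0.
have := carryC a u; have := carryC b u; rewrite /carry.
have -> : u + a = a + u by exact: addrC.
have -> : u + b = b + u by exact: addrC.
move=> -> -> W /orP[mn|/andP[/eqP-> ab]]; last first.
  move: W; rewrite (clt0_asym ab).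
  have : a + u != b + u.
    by rewrite (inj_eq (addIr u)); apply: contraTneq ab => ->; rewrite clt0_irr.
  move/clt0_total.
  by do 4!case: (clt0 _ _) => //=; lia.
move: W => _; have [au|_] := boolP (clt0 (a + u : G) u); last by case: (clt0 _ u); lia.
have [_|/negbTE bu] := boolP (clt0 (b + u : G) u); first by lia.
have -> : clt0 (a + u : G) (b + u).
  have [<-//|ne] := eqVneq u (b + u : G).
  by have := clt0_total ne; rewrite bu orbF; apply: clt0_trans.
lia.
Qed.

Lemma uw_ltD u x y : uw_lt (x + u) (y + u) = uw_lt x y.
Proof.
apply/idP/idP => [/(uw_lt_add (- u))|/(uw_lt_add u)//].
by rewrite !addrK.
Qed.

Lemma uw_lt_opp x : uw_lt 0 (- x) = uw_lt x 0.
Proof. by rewrite -(uw_ltD x) add0r addNr. Qed.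

Lemma uw_lt_sub x y : uw_lt 0 (y - x) = uw_lt x y.
Proof. by rewrite -(uw_ltD x) add0r subrK. Qed.

Lemma uw_ptD x y : uw_pt (x + y) = uw_pt x + uw_pt y.
Proof. by case: x y => [m a] [n b]; rewrite uw_addUE. Qed.

Lemma uw_ptN x : uw_pt (- x) = - uw_pt x.
Proof.
by apply/eqP; rewrite -addr_eq0 -uw_ptD addNr.
Qed.

Lemma uw_z_gt0 : uw_lt 0 uw_z.
Proof. by []. Qed.

Lemma uw_zMn n : uw_z *+ n = Unwound n%:Z 0.
Proof.
elim: n => [//|n IH]; rewrite mulrS IH uw_addUE /carry addr0 clt0_irr.
by congr Unwound; lia.
Qed.

Lemma uw_z_cofinal x : exists n, uw_lt x (uw_z *+ n).
Proof.
case: x => m a; exists (absz m).+1; rewrite uw_zMn uw_ltE.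
by apply/orP; left; lia.
Qed.

End Unwound.

Arguments uw_z : clear implicits.
Arguments uw_z_gt0 {G}.

Section LinearPart.
Variable G : cogroupType.
Local Notation unwound := (unwound G).
Local Notation uw_z := (uw_z G).
Implicit Types (x y z u : unwound) (a b c h : G).

Definition convex_subgroup (S : set unwound) : Prop :=
  [/\ S 0, forall x y, S x -> S y -> S (x - y)
    & forall x y z, S x -> S z -> uw_lt x y -> uw_lt y z -> S y].

Definition proper_convex_subgroup (S : set unwound) : Prop :=
  convex_subgroup S /\ S <> setT.

(* The union of all proper convex subgroups; it is the greatest one by
   [max_convex_proper] and [max_convex_max]. *)
Definition max_convex : set unwound :=
  [set x | exists2 S, proper_convex_subgroup S & S x].

Lemma convexN S x : convex_subgroup S -> S x -> S (- x).
Proof. by case=> S0 SB _ Sx; rewrite -sub0r; apply: SB. Qed.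

Lemma convexD S x y : convex_subgroup S -> S x -> S y -> S (x + y).
Proof.
by move=> cS Sx Sy; rewrite -[y]opprK; case: (cS) => _ SB _; apply: SB => //;
  apply: convexN.
Qed.

Lemma convex_total S T :
  convex_subgroup S -> convex_subgroup T -> S `<=` T \/ T `<=` S.
Proof.
move=> cS cT; have [|/existsNP[s /not_implyP[Ss Ts]]] := pselect (S `<=` T).
  by left.
right; wlog s0 : s Ss Ts / uw_lt 0 s => [hw t Tt|].
  have [e|] := eqVneq s 0; first by case: Ts; rewrite e; case: cT.
  case/uw_lt_total/orP => [h|h]; last exact: (hw s).
  apply: (hw (- s)) => //; first exact: convexN.
  - by move/(convexN cT); rewrite opprK.
  - by rewrite uw_lt_opp.
have lt_s t : T t -> uw_lt t s.
  move=> Tt; have : t != s by apply: contra_notN Ts => /eqP<-.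
  case/uw_lt_total/orP => // st; case: Ts.
  by case: cT => T0 _; apply; [exact: T0|exact: Tt|..].
move=> t Tt; case: (cS) => _ _; apply; [|exact: Ss| |exact: lt_s].
- exact: convexN Ss.
- rewrite -(uw_ltD s) addNr addrC -[t]opprK uw_lt_sub.
  by apply: lt_s; apply: convexN.
Qed.

Lemma proper_convex_z S : proper_convex_subgroup S -> ~ S uw_z.
Proof.
case=> cS ST Sz; apply: ST; apply/seteqP; split=> // x _.
have Szn n : S (uw_z *+ n).
  elim: n => [|n IH]; first by case: cS.
  by rewrite mulrS; apply: convexD.
have [n xn] := uw_z_cofinal x; have [m xm] := uw_z_cofinal (- x).
case: (cS) => _ _; apply; [exact: (convexN cS (Szn m))|exact: (Szn n)| |] => //.
by rewrite -(uw_ltD (uw_z *+ m)) addNr addrC -[x]opprK uw_lt_sub.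
Qed.

Lemma max_convex_proper : proper_convex_subgroup max_convex.
Proof.
split; last first.
  move=> e; have [S pS] : max_convex uw_z by rewrite e.
  exact: proper_convex_z.
split.
- exists [set 0] => //; split; last first.
    by move=> e; have : [set 0] uw_z by rewrite e.
  split=> // [x y -> ->|x y z -> ->]; first by rewrite /= subr0.
  by move=> h /(uw_lt_trans h); rewrite uw_lt_irr.
- move=> x y [S pS Sx] [T pT Ty].
  have [ST|TS] := convex_total pS.1 pT.1; [exists T|exists S] => //.
  + by case: pT => -[_ TB _] _; apply: TB => //; apply: ST.
  + by case: pS => -[_ SB _] _; apply: SB => //; apply: TS.
- move=> x y z [S pS Sx] [T pT Tz] xy yz.
  have [ST|TS] := convex_total pS.1 pT.1; [exists T|exists S] => //.
  + by case: pT => -[_ _ TC] _; apply: TC xy yz => //; apply: ST.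
  + by case: pS => -[_ _ SC] _; apply: SC xy yz => //; apply: TS.
Qed.

Lemma max_convex_max S : proper_convex_subgroup S -> S `<=` max_convex.
Proof. by move=> pS x Sx; exists S. Qed.

Lemma max_convexN x : max_convex x -> max_convex (- x).
Proof. exact: convexN max_convex_proper.1. Qed.

Lemma max_convexD x y : max_convex x -> max_convex y -> max_convex (x + y).
Proof. exact: convexD max_convex_proper.1. Qed.

Lemma max_convex_lt x y :
  max_convex x -> uw_lt 0 y -> ~ max_convex y -> uw_lt x y.
Proof.
move=> Cx y0 Cy; have : x != y by apply: contra_notN Cy => /eqP<-.
case/uw_lt_total/orP => // yx; case: Cy.
by case: max_convex_proper => -[C0 _ CC] _; apply: CC y0 yx.
Qed.

Lemma max_convex_pt_inj x y :
  max_convex x -> max_convex y -> uw_pt x = uw_pt y -> x = y.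
Proof.
move=> Cx Cy xy; apply/eqP; rewrite -subr_eq0; apply/eqP.
have : max_convex (x - y) by apply: max_convexD => //; apply: max_convexN.
have : uw_pt (x - y) = 0 by rewrite uw_ptD uw_ptN xy subrr.
have Cz := proper_convex_z max_convex_proper.
case: (x - y) => m a /= -> Cm.
have := max_convex_lt Cm uw_z_gt0 Cz.
have := max_convex_lt (max_convexN Cm) uw_z_gt0 Cz.
have -> : - Unwound m 0 = Unwound (- m) (0 : G).
  by apply/eqP; rewrite eq_sym -addr_eq0 uw_addUE /carry addr0 clt0_irr addNr.
rewrite !uw_ltE clt0_irr !andbF !orbF => h1 h2.
by have -> : m = 0 by lia.
Qed.

Definition lin_part : {pred G} :=
  [pred a | `[< exists2 x, max_convex x & uw_pt x = a >]].

Lemma lin_partP a :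
  reflect (exists2 x, max_convex x & uw_pt x = a) (a \in lin_part).
Proof. exact: asboolP. Qed.

Fact lin_part_closed : zmod_closed lin_part.
Proof.
split=> [|a b /lin_partP[x Cx <-] /lin_partP[y Cy <-]]; apply/lin_partP.
  by exists 0 => //; case: max_convex_proper => -[].
exists (x - y); last by rewrite uw_ptD uw_ptN.
by apply: max_convexD => //; apply: max_convexN.
Qed.

HB.instance Definition _ := GRing.isZmodClosed.Build G lin_part lin_part_closed.

Lemma cyc_lin_mid h a b c : h \in lin_part -> b - a \notin lin_part ->
  c - b \notin lin_part -> cyc a b c -> cyc a (b + h) c.
Proof.
move=> hL baL cbL /(cyc_add (- a)) abc.
suff : cyc 0 (b - a + h) (c - a).
  by move/(cyc_add a); rewrite add0r addrAC !subrK.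
rewrite subrr in abc; have {cbL} : (c - a) - (b - a) \notin lin_part.
  by rewrite opprB addrA subrK.
move: (b - a) (c - a) baL abc => {}b {}c bL bc cbL {a}.
have [x Cx xh] := lin_partP _ hL.
have [b0 _ c0] := cyc_neq bc.
pose X := Unwound 0 b; pose Y := Unwound 0 c.
have X0 : uw_lt 0 X by rewrite uw_ltE ltxx /clt0 /= eqxx eq_sym b0 orbT.
have XY : uw_lt X Y by rewrite uw_ltE /clt0 bc.
have CX : ~ max_convex X.
  by move=> CX; case/negP: bL; apply/lin_partP; exists X.
have CYX : ~ max_convex (Y - X).
  move=> CYX; case/negP: cbL; apply/lin_partP; exists (Y - X) => //.
  by rewrite uw_ptD uw_ptN.
have h1 : uw_lt 0 (X + x).
  by rewrite -[x]opprK uw_lt_sub; apply: max_convex_lt => //; apply: max_convexN.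
have h2 : uw_lt (X + x) Y.
  rewrite -(uw_ltD (- X)) [X + x]addrC addrK.
  by apply: max_convex_lt => //; rewrite uw_lt_sub.
have : uw_pt (X + x) = b + h by rewrite uw_ptD xh.
case: (X + x) h1 h2 => k d /= h1 h2 <-.
move: h1 h2; rewrite !uw_ltE => h1 h2.
have k0 : k = 0.
  by case/orP: h1 => [h1|/andP[/eqP<-//]]; case/orP: h2 => [|/andP[/eqP]//]; lia.
move: h1 h2; rewrite k0 !ltxx eqxx /= /clt0 => /orP[/cyc_neq[/eqP//]|/andP[_ d0]].
by rewrite (negPf d0) orbF.
Qed.

Lemma cyc_lin a b c a' b' c' :
  a' - a \in lin_part -> b' - b \in lin_part -> c' - c \in lin_part ->
  b - a \notin lin_part -> c - b \notin lin_part -> a - c \notin lin_part ->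
  cyc a b c -> cyc a' b' c'.
Proof.
move=> aL bL cL ba cb ac abc.
have e (d d' : G) : d' = d + (d' - d) by rewrite addrC subrK.
have Lr (u v w : G) : w - v \in lin_part ->
    u - v \notin lin_part -> u - w \notin lin_part.
  by move=> wv; apply: contra => uw; rewrite -(subrK w u) -addrA rpredD.
have Ll (u v w : G) : w - v \in lin_part ->
    v - u \notin lin_part -> w - u \notin lin_part.
  by move=> wv; rewrite -opprB rpredN => /(Lr _ _ _ wv); rewrite -opprB rpredN.
have h1 : cyc a b' c by rewrite (e b b'); apply: cyc_lin_mid.
have h2 : cyc b' c' a.
  rewrite (e c c'); apply: cyc_lin_mid => //; first exact: Lr bL cb.
  exact: cyc_rot.
apply: cyc_rot; rewrite (e a a').
apply: cyc_lin_mid => //; first exact: Lr cL ac.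
  exact: Ll bL ba.
exact: cyc_rot.
Qed.

(* The order inherited from the unwound, through the lifts in [max_convex],
   which are unique by [max_convex_pt_inj]. *)
Definition lin_lt (a b : subco lin_part) : Prop :=
  exists x y, [/\ max_convex x, max_convex y, uw_pt x = val a,
                  uw_pt y = val b & uw_lt x y].

Definition c_archimedean : Prop := forall a, a \in lin_part -> a = 0.

Definition co_quot := {ideal_quot lin_part}.
HB.instance Definition _ := GRing.Zmodule.on co_quot.
HB.instance Definition _ := EqQuotient.on co_quot.

Implicit Types A B C U : co_quot.

(* Independent of the representatives by [co_quot_cycE]. *)
Definition co_quot_cyc A B C : bool :=
  [&& A != B, B != C, A != C & cyc (repr A) (repr B) (repr C)].

Lemma co_quot_eqE a b : (\pi_co_quot a == \pi_co_quot b) = (a - b \in lin_part).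
Proof. by rewrite -Quotient.idealrBE. Qed.

Lemma co_quot_cyc_pi a b c :
  \pi_co_quot a != \pi_co_quot b -> \pi_co_quot b != \pi_co_quot c ->
  \pi_co_quot a != \pi_co_quot c ->
  co_quot_cyc (\pi_co_quot a) (\pi_co_quot b) (\pi_co_quot c) = cyc a b c.
Proof.
move=> ab bc ac; rewrite /co_quot_cyc ab bc ac /=.
have r (d : G) : repr (\pi_co_quot d) - d \in lin_part.
  by rewrite -co_quot_eqE reprK.
have r' (d : G) : d - repr (\pi_co_quot d) \in lin_part.
  by rewrite -co_quot_eqE reprK.
apply/idP/idP; apply: cyc_lin; rewrite ?r ?r' // -co_quot_eqE ?reprK //;
  by rewrite eq_sym.
Qed.

Fact co_quot_cyc_neq A B C :
  co_quot_cyc A B C -> [/\ A != B, B != C & A != C].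
Proof. by case/and4P. Qed.

Fact co_quot_cyc_rot A B C : co_quot_cyc A B C -> co_quot_cyc B C A.
Proof.
case/and4P=> AB BC AC h; apply/and4P; split=> //; try by rewrite eq_sym.
exact: cyc_rot.
Qed.

Fact co_quot_cyc_trans C A B D :
  co_quot_cyc C A B -> co_quot_cyc C B D -> co_quot_cyc C A D.
Proof.
case/and4P=> CA AB CB h /and4P[_ BD CD h']; apply/and4P; split=> //.
  by apply: contraTneq h' => <-; rewrite cyc_asym.
exact: cyc_trans h h'.
Qed.

Fact co_quot_cyc_total C A B :
  A != C -> B != C -> A != B -> co_quot_cyc C A B || co_quot_cyc C B A.
Proof.
move=> hAC hBC hAB; rewrite /co_quot_cyc ![C == _]eq_sym [B == A]eq_sym hAC hBC hAB /=.
by apply: cyc_total; rewrite (inj_eq (can_inj reprK)).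
Qed.

Fact co_quot_cyc_add U A B C :
  co_quot_cyc A B C -> co_quot_cyc (A + U) (B + U) (C + U).
Proof.
rewrite -[A]reprK -[B]reprK -[C]reprK -[U]reprK -!raddfD => h.
have [ab bc ac] := co_quot_cyc_neq h.
rewrite co_quot_cyc_pi ?raddfD ?(inj_eq (addIr _)) // cyc_addE.
by rewrite -co_quot_cyc_pi.
Qed.

HB.instance Definition _ := isCyclicallyOrdered.Build co_quot co_quot_cyc_neq
  co_quot_cyc_rot co_quot_cyc_trans co_quot_cyc_total co_quot_cyc_add.

Lemma co_quot_cycE a b c :
  \pi_co_quot a != \pi_co_quot b -> \pi_co_quot b != \pi_co_quot c ->
  \pi_co_quot a != \pi_co_quot c ->
  cyc (\pi_co_quot a) (\pi_co_quot b) (\pi_co_quot c) = cyc a b c.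
Proof. exact: co_quot_cyc_pi. Qed.

End LinearPart.

Arguments lin_part : clear implicits.
Arguments c_archimedean : clear implicits.
Arguments co_quot : clear implicits.

Definition lin_part_isoZ (G : cogroupType) : Prop :=
  exists f : {additive int -> subco (lin_part G)},
    bijective f /\ forall m n : int, lin_lt (f m) (f n) <-> m < n.

Section Circle.
Variable R : realType.

Definition circle : set R[i] := [set z | `|z| = 1].

Definition roots_of_unity : set R[i] :=
  [set z | exists2 n, (0 < n)%N & z ^+ n = 1].

Definition expi (t : R) : R[i] := (cos t +i* sin t)%C.

Definition circle_cyc (z1 z2 z3 : R[i]) : Prop :=
  exists t1 t2 t3 : R,
    [/\ [/\ 0 <= t1 < 2 * pi, 0 <= t2 < 2 * pi & 0 <= t3 < 2 * pi],
        [/\ z1 = expi t1, z2 = expi t2 & z3 = expi t3] &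
        [\/ t1 < t2 < t3, t2 < t3 < t1 | t3 < t1 < t2]].

Definition circle_embedding (K : cogroupType) (f : K -> R[i]) : Prop :=
  [/\ forall a, circle (f a), injective f,
      forall a b, f (a + b) = f a * f b &
      forall a b c, cyc a b c <-> circle_cyc (f a) (f b) (f c)].

(* [K], identified with its image in the circle, is [S]. *)
Definition circle_image (K : cogroupType) (S : set R[i]) : Prop :=
  exists2 f : K -> R[i], circle_embedding f & range f = S.

End Circle.

Arguments roots_of_unity : clear implicits.

Inductive co_term : Type :=
| co_var of nat
| co_zero
| co_opp of co_term
| co_add of co_term & co_term.

Inductive co_formula : Type :=
| co_eq of co_term & co_term
| co_cyc of co_term & co_term & co_term
| co_not of co_formula
| co_and of co_formula & co_formula
| co_ex of nat & co_formula.

Section Satisfaction.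
Variable G : cogroupType.

Fixpoint co_eval (e : nat -> G) (t : co_term) : G :=
  match t with
  | co_var i => e i
  | co_zero => 0
  | co_opp t1 => - co_eval e t1
  | co_add t1 t2 => co_eval e t1 + co_eval e t2
  end.

Fixpoint co_sat (e : nat -> G) (phi : co_formula) : Prop :=
  match phi with
  | co_eq t1 t2 => co_eval e t1 = co_eval e t2
  | co_cyc t1 t2 t3 => cyc (co_eval e t1) (co_eval e t2) (co_eval e t3)
  | co_not p => ~ co_sat e p
  | co_and p q => co_sat e p /\ co_sat e q
  | co_ex i p => exists a : G, co_sat (fun j => if j == i then a else e j) p
  end.

End Satisfaction.

Definition elementary_subgroup (G : cogroupType) (H : zmodClosed G) : Prop :=
  forall (phi : co_formula) (e : nat -> subco H),
    co_sat e phi <-> co_sat (fun i => val (e i)) phi.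

(* Main.v *)
Require Import Defs.
From HB Require Import structures.
From mathcomp Require Import all_boot all_order all_algebra.
From mathcomp Require Import generic_quotient complex.
From mathcomp Require Import all_classical all_reals all_analysis.
From mathcomp Require Import zify ring lra.

Set Implicit Arguments.
Unset Strict Implicit.
Unset Printing Implicit Defensive.

Import Order.TTheory GRing.Theory Num.Theory.

Local Open Scope classical_set_scope.
Local Open Scope quotient_scope.
Local Open Scope ring_scope.

(* Let [e] be the least nonzero element of [G] for [cyc 0] and [z] the turn of
   the unwound of [G]. C-regularity makes the unwound a model of Presburger
   arithmetic with unit [e] (every element is congruent to a multiple of [e]
   modulo each [n > 0]), and [z] is infinite because [G] is not c-archimedean.
   The subgroup [H] is the pure hull of [e]: its unwound is the pure hull of [e]
   and [z], hence again such a model. Elementarity is Presburger's quantifier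
   elimination, phrased as a back-and-forth between assignments on which
   finitely many linear forms have the same signs and all variables have the
   same residues. In the unwound of [H] every [x] satisfies
   [n x = a e + b z] for some [n > 0]; the rational [b / n] is the angle of [x]
   measured in turns, and its kernel, the multiples of [e], is the linear
   part. *)

(** * Ordered arithmetic in the unwound *)

(* In the square-zero extension of [int] by [V], the tactic [ring] proves
   linear identities of [V]. *)
Section SquareZero.
Variable V : zmodType.

Definition square_zero : Type := (int * V)%type.
HB.instance Definition _ := GRing.Zmodule.on square_zero.

Implicit Types x y z : square_zero.

Definition sqz_one : square_zero := (1, 0).
Definition sqz_mul x y : square_zero := (x.1 * y.1, y.2 *~ x.1 + x.2 *~ y.1).

Fact sqz_mulA : associative sqz_mul.
Proof.
move=> [a u] [b v] [c w]; congr (_, _) => /=; first by rewrite mulrA.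
by rewrite !mulrzDl -!mulrzA addrA (mulrC b a) (mulrC c a).
Qed.

Fact sqz_mulC : commutative sqz_mul.
Proof.
by move=> [a u] [b v]; congr (_, _) => /=; [rewrite mulrC|rewrite addrC].
Qed.

Fact sqz_mul1 : left_id sqz_one sqz_mul.
Proof. by move=> [a u]; congr (_, _) => /=; rewrite ?mul1r // mul0rz addr0. Qed.

Fact sqz_mulD : left_distributive sqz_mul +%R.
Proof.
move=> [a u] [b v] [c w]; congr (_, _) => /=; first by rewrite mulrDl.
by rewrite mulrzDr mulrzDl addrACA.
Qed.

HB.instance Definition _ := GRing.Zmodule_isComPzRing.Build square_zero
  sqz_mulA sqz_mulC sqz_mul1 sqz_mulD.

Definition sqz_in (v : V) : square_zero := (0, v).

Fact sqz_in_additive : additive sqz_in.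
Proof. by move=> u v; congr (_, _); rewrite subr0. Qed.

HB.instance Definition _ :=
  GRing.isZmodMorphism.Build V square_zero sqz_in sqz_in_additive.

Lemma sqz_in_inj : injective sqz_in. Proof. by move=> u v []. Qed.

End SquareZero.

Ltac zmod := apply: sqz_in_inj; ring.

Section UnwoundOrder.
Variable G : cogroupType.
Local Notation unwound := (unwound G).
Implicit Types (x y z u : unwound) (a b c : G).

HB.instance Definition _ := Order.Lt_isPOrder.Build ring_display unwound
  (@uw_lt_irr G) (fun y x z => @uw_lt_trans G y x z).

Fact uw_le_total : total (<=%O : rel unwound).
Proof.
move=> x y; rewrite !le_eqVlt [y == x]eq_sym.
by case: eqVneq => //= xy; apply: uw_lt_total.
Qed.

HB.instance Definition _ := Order.POrder_isTotal.Build ring_display unwound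
  uw_le_total.

Lemma uw_lt_lt x y : uw_lt x y = (x < y).
Proof. by []. Qed.

Lemma ltUE m a n b :
  (Unwound m a < Unwound n b) = (m < n) || (m == n) && clt0 a b.
Proof. by []. Qed.

Lemma ltU_subr x y : (0 < y - x) = (x < y).
Proof. exact: uw_lt_sub. Qed.

Lemma leU_subr x y : (0 <= y - x) = (x <= y).
Proof. by rewrite !leNgt -[in RHS]ltU_subr -[in LHS]ltU_subr sub0r opprB. Qed.

Lemma addU_gt0 x y : 0 < x -> 0 <= y -> 0 < x + y.
Proof.
move=> x0 y0; apply: lt_le_trans x0 _; rewrite -leU_subr.
by have -> : x + y - x = y by zmod.
Qed.

Lemma addU_ge0 x y : 0 <= x -> 0 <= y -> 0 <= x + y.
Proof.
rewrite le_eqVlt => /orP[/eqP <-|x0 y0]; first by rewrite add0r.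
exact/ltW/addU_gt0.
Qed.

Lemma mulUn_ge0 x n : 0 <= x -> 0 <= x *+ n.
Proof.
by move=> x0; elim: n => [|n IH]; rewrite ?mulr0n // mulrS addU_ge0.
Qed.

Lemma mulUn_gt0 x n : 0 < x -> (0 < n)%N -> 0 < x *+ n.
Proof.
by case: n => // n x0 _; rewrite mulrS addU_gt0 // mulUn_ge0 // ltW.
Qed.

Lemma mulUz_ge0 x (k : int) : 0 <= x -> 0 <= k -> 0 <= x *~ k.
Proof. by move=> x0; case: k => // n _; apply: mulUn_ge0. Qed.

Lemma mulUz_gt0 x (k : int) : 0 < x -> 0 < k -> 0 < x *~ k.
Proof. by move=> x0; case: k => // n n0; apply: mulUn_gt0. Qed.

Lemma ltU_pMz2r x y (k : int) : 0 < k -> (x *~ k < y *~ k) = (x < y).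
Proof.
move=> k0; have [xy|yx|->] := ltgtP x y; last by rewrite ltxx.
  by rewrite -ltU_subr -mulrzBl mulUz_gt0 // ltU_subr.
apply/negbTE; rewrite -leNgt -leU_subr -mulrzBl mulUz_ge0 ?leU_subr //;
  exact: ltW.
Qed.

End UnwoundOrder.

(** * C-regularity and Presburger arithmetic *)

Section ZGroup.
Variable G : cogroupType.
Local Notation unwound := (unwound G).
Local Notation z := (uw_z G).
Implicit Types (x y w : unwound) (a b c e : G).

Definition uw_lift a : unwound := Unwound 0 a.

(** The interval from [0] to [z] is a fundamental domain modulo [z], with [uw_lift a] as the
    representative of [a]. *)
Lemma uw_ltz x : (0 <= x < z) = (uw_turn x == 0).
Proof.
case: x => m a; rewrite leNgt !ltUE /= clt0x0 andbF orbF.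
by case: (m == 0) / eqP => [->|]; rewrite /= ?clt0x0 ?andbF //; lia.
Qed.

Lemma uw_turnDz x (k : int) : uw_turn (x + z *~ k) = uw_turn x + k.
Proof.
have zk : z *~ k = Unwound k 0.
  case: k => n; first by rewrite -pmulrn uw_zMn.
  apply/eqP; rewrite NegzE mulrNz -subr_eq0 -opprD oppr_eq0 -pmulrn uw_zMn uw_addUE.
  by rewrite /carry addr0 clt0_irr; apply/eqP; congr Unwound; lia.
case: x => m a; rewrite zk uw_addUE /carry addr0 clt0_irr /=.
by rewrite addr0.
Qed.

Lemma uw_ptz (k : int) : uw_pt (z *~ k) = 0.
Proof.
case: k => n; first by rewrite -pmulrn uw_zMn.
by rewrite NegzE mulrNz uw_ptN -pmulrn uw_zMn oppr0.
Qed.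

(** The kernel of [uw_pt] is generated by [z]; the turns determine the multiplier. *)
Lemma uw_eqz x y : uw_pt x = uw_pt y -> x = y + z *~ (uw_turn x - uw_turn y).
Proof.
move=> xy.
have : uw_pt (y + z *~ (uw_turn x - uw_turn y)) = uw_pt x by rewrite uw_ptD uw_ptz addr0.
have := uw_turnDz y (uw_turn x - uw_turn y).
move: (_ + _) => w; case: x w {xy} => m a [n b] /= -> ->.
by congr Unwound; lia.
Qed.

Lemma uw_ptMn x n : uw_pt (x *+ n) = uw_pt x *+ n.
Proof. by elim: n => // n IH; rewrite !mulrS uw_ptD IH. Qed.

Lemma uw_ptMz x (k : int) : uw_pt (x *~ k) = uw_pt x *~ k.
Proof.
case: k => n; first exact: uw_ptMn.
by rewrite NegzE !mulrNz uw_ptN -!pmulrn uw_ptMn.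
Qed.

(* The first, second and fourth fields say that the unwound is a model of
   Presburger arithmetic with unit [uw_lift e]. *)
Record presburger e : Prop := Presburger {
  pres_neq0 : e != 0;
  pres_min : forall a, a != 0 -> a = e \/ cyc 0 e a;
  pres_inf : forall k : int, uw_lift e *~ k < z;
  pres_div : forall n x, (0 < n)%N ->
    exists y (r : int), x = y *+ n + uw_lift e *~ r }.

Section Min.
Variable e : G.
Hypotheses (e0 : e != 0) (e_min : forall a, a != 0 -> a = e \/ cyc 0 e a).
Local Notation eps := (uw_lift e).

Lemma eps_gt0 : 0 < eps.
Proof. by rewrite ltUE ltxx eqxx /clt0 eqxx e0 orbT. Qed.

Lemma eps_le x : 0 < x -> eps <= x.
Proof.
case: x => m a; rewrite leNgt !ltUE => /orP[m0|/andP[/eqP<-]].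
  by rewrite negb_or -leNgt ltW //= gt_eqF.
rewrite ltxx eqxx /=; have [->|a0 _] := eqVneq a 0; first by rewrite clt0x0.
have [->|h] := e_min a0; first by rewrite clt0_irr.
by rewrite clt0_asym // /clt0 h.
Qed.

(** Discreteness: an element above [eps *+ n] is at least [eps *+ n.+1], so nothing lies between
    consecutive multiples of [eps]. *)
Lemma eps_interval x n : 0 <= x -> x <= eps *+ n -> exists2 j, (j <= n)%N & x = eps *+ j.
Proof.
move=> x0; elim: n => [|n IH] xn.
  by exists 0%N => //; apply/eqP; rewrite eq_le xn.
have [/IH[j jn ->]|nx] := leP x (eps *+ n); first by exists j => //; apply: leqW.
exists n.+1 => //; apply/eqP; rewrite eq_le xn /= mulrSr -leU_subr.
have -> : x - (eps *+ n + eps) = x - eps *+ n - eps by zmod.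
by rewrite leU_subr; apply: eps_le; rewrite ltU_subr.
Qed.

End Min.

Lemma clt0_between a c b : clt0 a b -> cyc a c b -> clt0 a c /\ clt0 c b.
Proof.
move=> ab acb; have [ac cb _] := cyc_neq acb.
case/orP: (clt0_total ac) => [h|/clt0_cyc/(_ ab)]; last first.
  by rewrite cyc_asym //; apply: cyc_rot.
split=> //; case/orP: (clt0_total cb) => // /(clt0_cyc ab).
by move/(cyc_asym); rewrite acb.
Qed.

Lemma cyc_seq_incr (s : seq G) :
  (forall i j, (i < j < size s)%N -> clt0 s`_i s`_j) -> cyc_seq s.
Proof.
move=> h i j k /andP[ij jk] ks; apply: clt0_cyc; apply: h; rewrite ?ij ?jk //.
exact: ltn_trans ks.
Qed.

Section Regular.
Variable e : G.
Hypotheses (e0 : e != 0) (e_min : forall a, a != 0 -> a = e \/ cyc 0 e a).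
Hypothesis e_inf : forall k : int, uw_lift e *~ k < z.
Hypothesis G_regular : c_regular G.
Local Notation eps := (uw_lift e).

(* The conclusion of c-regularity only determines [y *+ n] up to one turn. *)
Lemma regular_div n w : (1 < n)%N -> 0 <= w -> w + eps *+ n < z ->
  exists y (t : bool) j, [/\ 0 <= y < z, y *+ n.-1 < w + eps *+ n, (0 < j <= n)%N &
    y *+ n = z *+ t + w + eps *+ j].
Proof.
(* C-regularity is applied to [n] consecutive points above [w], so that [y *+ n] is confined, up to
   a turn, to one of them. *)
move=> n1 w0 wz; pose x i := if i is 0%N then 0 else w + eps *+ i.
have eps0 := eps_gt0 e0.
have x_lt i j : (i < j)%N -> x i < x j.
  case: i j => [|i] [|j] //= ij; first by rewrite addrC addU_gt0 // mulUn_gt0.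
  rewrite -ltU_subr (_ : _ - _ = eps *+ j.+1 - eps *+ i.+1); last by zmod.
  by rewrite -mulrnBr ?mulUn_gt0 ?subn_gt0 // ltnW.
have x_turn i : (i <= n)%N -> uw_turn (x i) = 0.
  move=> i_n; apply/eqP; rewrite -uw_ltz; apply/andP; split.
    by case: i {i_n} => // i; rewrite ltW // (x_lt 0).
  have : x n < z by case: (n) n1 wz.
  move: i_n; rewrite leq_eqVlt => /orP[/eqP->//|/x_lt]; exact: lt_trans.
have x_clt i j : (i < j <= n)%N -> clt0 (uw_pt (x i)) (uw_pt (x j)).
  move=> /andP[ij jn]; have := x_lt _ _ ij.
  move: (x_turn j jn) (x_turn i (leq_trans (ltnW ij) jn)).
  case: (x i) (x j) => [m a] [p b] /= -> ->.
  by rewrite ltUE ltxx eqxx.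
have x_nth i : (i <= n)%N ->
    (0 :: [seq uw_pt (x i) | i <- iota 1 n])`_i = uw_pt (x i).
  case: i => // i i_n /=.
  by rewrite (nth_map 0%N) ?size_iota // nth_iota // add1n.
have [|y hy hc] := G_regular n1 (x := fun i => uw_pt (x i)).
  apply: cyc_seq_incr => i j; rewrite /= size_map size_iota ltnS => /andP[ij jn].
  by rewrite !x_nth ?x_clt ?ij // (leq_trans (ltnW ij)).
have xn : x n = w + eps *+ n by case: (n) n1.
pose Y := uw_lift y.
have c_nth i : (i < n)%N ->
    (rcons [seq y *+ i | i <- iota 0 n] (uw_pt (x n)))`_i = y *+ i.
  move=> i_n; rewrite nth_rcons size_map size_iota i_n (nth_map 0%N) ?size_iota //.
  by rewrite nth_iota.
(* The multiples of [y] increase from 0 up to [y *+ n.-1], so the additions building [Y *+ n.-1]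
   carry no turn. Only the last addition can, which produces [t]. *)
have y_incr i : (i.+1 < n)%N -> clt0 (y *+ i.+1) (y *+ i) = false.
  case: i => [|i] i_n; first by rewrite clt0x0.
  have := hc 0%N i.+1 i.+2.
  rewrite !c_nth ?mulr0n ?size_rcons ?size_map ?size_iota //; last first.
  - lia.
  - lia.
  move=> h; apply: clt0_asym; rewrite /clt0 h //; lia.
have Yn i : (i < n)%N -> Y *+ i = Unwound 0 (y *+ i).
  elim: i => // i IH i_n; rewrite !mulrSr IH 1?ltnW // uw_addUE /carry.
  by rewrite -mulrSr y_incr.
have n1n : (n.-1 < n)%N by lia.
have yn1 : clt0 (y *+ n.-1) (uw_pt (x n)).
  have := hc 0%N n.-1 n; rewrite (c_nth 0%N) ?(c_nth n.-1) //; last exact: ltnW.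
  rewrite nth_rcons size_rcons size_map size_iota ltnn eqxx mulr0n /clt0.
  by move=> -> //; lia.
have [t Ynn] : exists t : bool, Y *+ n = Unwound t%:Z (y *+ n).
  exists (clt0 (y *+ n) (y *+ n.-1)).
  rewrite -[in LHS](prednK (ltnW n1)) mulrSr Yn // uw_addUE /carry.
  by rewrite !add0r -mulrSr prednK // ltnW.
have Yt : Y *+ n - z *+ t = Unwound 0 (y *+ n).
  rewrite [LHS](@uw_eqz _ (Unwound 0 (y *+ n))) /=.
    have -> : Y *+ n - z *+ t = Y *+ n + z *~ (- t%:Z) by zmod.
    by rewrite uw_turnDz Ynn /= subrr subr0 mulr0z addr0.
  by rewrite uw_ptD uw_ptN (pmulrn z) uw_ptz uw_ptMn subr0.
have x1n : clt0 (uw_pt (x 1%N)) (uw_pt (x n)) by apply: x_clt; rewrite n1 /=.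
have Yx1 : x 1%N <= Y *+ n - z *+ t.
  rewrite leNgt Yt; move: (x_turn 1%N (ltnW n1)) hy x1n.
  case: (x 1%N) => [m a] /= ->; rewrite ltUE ltxx eqxx /=.
  case=> [->|->|h] ab; first by rewrite clt0_irr.
    by rewrite clt0_asym.
  by rewrite clt0_asym //; case: (clt0_between ab h).
have Yxn : Y *+ n - z *+ t <= x n.
  rewrite leNgt Yt; move: (x_turn n (leqnn n)) hy x1n.
  case: (x n) => [m b] /= ->; rewrite ltUE ltxx eqxx /=.
  case=> [->|->|h] ab; last by rewrite clt0_asym //; case: (clt0_between ab h).
    by rewrite clt0_asym.
  by rewrite clt0_irr.
have [||j jn hj] := @eps_interval e e_min (Y *+ n - z *+ t - w) n.
- rewrite leU_subr; apply: le_trans Yx1; rewrite -leU_subr.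
  by rewrite /= (_ : _ - _ = eps) ?ltW //; zmod.
- rewrite -leU_subr (_ : _ - _ = x n - (Y *+ n - z *+ t)) ?leU_subr //.
  by rewrite xn; zmod.
exists Y, t, j; split=> //.
- by rewrite uw_ltz.
- rewrite -xn Yn //; move: yn1 (x_turn n (leqnn n)).
  by case: (x n) => [m a] /= h ->; rewrite ltUE ltxx eqxx h.
- rewrite jn andbT lt0n; apply: contraTneq Yx1 => j0.
  rewrite -ltNge -ltU_subr (_ : _ - _ = eps - (Y *+ n - z *+ t - w)).
    by rewrite hj j0 mulr0n subr0.
  by rewrite /=; zmod.
- by rewrite (_ : _ + w + _ = z *+ t + w + (Y *+ n - z *+ t - w)) -?hj //; zmod.
Qed.

(** [z] is divided first: its quotient absorbs the possible turn [t] when the other elements are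
    divided. *)
Lemma regular_div_z n : (1 < n)%N -> exists y (r : int), z = y *+ n + eps *~ r.
Proof.
move=> n1; have eps0 := eps_gt0 e0.
have e_infn m : 0 <= z - eps *+ m by rewrite leU_subr ltW // (e_inf m).
(* The choice of [w] makes [w + eps *+ n] equal to [z - eps], just below [z]. *)
have [|y [t [j [_ yn jn yE]]]] := @regular_div n (z - eps *+ n.+1) n1 (e_infn _).
  by rewrite -ltU_subr (_ : _ - _ = eps) //; zmod.
case: t yE => yE; last first.
  exists y, (n.+1%:Z - j%:Z); rewrite yE mulr0n add0r.
  by zmod.
(* Case [t = 1]: [y *+ n] is close to two turns, while [y *+ n.-1] is below [z - eps]. Multiplying
   the first by [n.-1] and the second by [n] gives a contradiction, because [2 * n.-1 >= n] and [z]
   exceeds every multiple of [eps]. *)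
case: n j n1 jn yn yE => [|[|n]] // [|j] // _ _ /= yn yE; exfalso.
have : 0 < (z - eps - y *+ n.+1) *+ n.+2.
  apply: mulUn_gt0 => //; rewrite ltU_subr.
  by rewrite (_ : z - eps = z - eps *+ n.+3 + eps *+ n.+2) //; zmod.
have -> : (z - eps - y *+ n.+1) *+ n.+2 = (z - eps) *+ n.+2 - y *+ n.+2 *+ n.+1.
  by zmod.
rewrite yE; apply/negP; rewrite -leNgt -leU_subr.
have -> : 0 - ((z - eps) *+ n.+2 -
    (z *+ true + (z - eps *+ n.+3) + eps *+ j.+1) *+ n.+1) =
    (z - eps *+ n.+2) *+ n + eps *+ j *+ n.+1 by rewrite mulr1n; zmod.
by apply: addU_ge0; rewrite ?mulUn_ge0 // ltW.
Qed.

Lemma regular_presburger : presburger e.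
Proof.
split=> // n x n0.
have [n1|] := ltnP 1 n; last first.
  case: n n0 => // -[|//] _ _; exists x, 0; rewrite mulr0z addr0 //.
have [yz [rz zE]] := regular_div_z n1.
have [y [r xE]] : exists y r, x - z *~ uw_turn x = y *+ n + eps *~ r.
  have : 0 <= x - z *~ uw_turn x < z.
    by rewrite uw_ltz -mulrNz uw_turnDz subrr.
  move: (x - _) => w /andP[w0 wz].
  (* If [w] is within [n] steps of [z], it is [z - eps *+ j] and the division of [z] serves;
     otherwise [regular_div] applies. *)
  have [wnz|zwn] := ltP (w + eps *+ n) z.
    have [y [t [j [_ _ _ yE]]]] := regular_div n1 w0 wnz.
    exists (y - yz *+ t), (- rz *+ t - j%:Z).
    have -> : w = y *+ n - z *+ t - eps *+ j by rewrite yE; zmod.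
    by rewrite {1}zE; zmod.
  have [||j _ jE] := @eps_interval e e_min (z - w) n.
  - by rewrite leU_subr ltW.
  - by rewrite -leU_subr (_ : _ - _ = w + eps *+ n - z) ?leU_subr //; zmod.
  exists yz, (rz - j%:Z).
  have -> : w = z - eps *+ j by rewrite -jE; zmod.
  by rewrite {1}zE; zmod.
exists (y + yz *~ uw_turn x), (r + rz * uw_turn x).
have {1}-> : x = y *+ n + eps *~ r + z *~ uw_turn x by rewrite -xE; zmod.
by rewrite {1}zE; zmod.
Qed.

End Regular.
End ZGroup.

(** * From Presburger arithmetic back to c-regularity *)

Section PresburgerRegular.
Variables (K : cogroupType) (e : K).
Hypothesis pK : presburger e.
Local Notation eps := (uw_lift e).
Local Notation z := (uw_z K).
Implicit Types (x y w : unwound K).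

Lemma pres_eps_gt0 : 0 < eps.
Proof. exact: eps_gt0 (pres_neq0 pK). Qed.

Lemma pres_eps_le x : 0 < x -> eps <= x.
Proof. exact: eps_le (pres_min pK) _. Qed.

Lemma pres_edivn n x : (0 < n)%N ->
  exists y (r : nat), (r < n)%N /\ x = y *+ n + eps *+ r.
Proof.
move=> n0; have [y [r ->]] := pres_div pK x n0.
have hr := divz_eq r n; have nz : n%:Z != 0 by case: n n0 {hr}.
exists (y + eps *~ (r %/ n)%Z), (absz (r %% n)%Z).
have r0 := modz_ge0 r nz; have rn : (r %% n)%Z < n by apply: ltz_pmod.
split; first by lia.
by rewrite (pmulrn eps) gez0_abs // {1}hr; zmod.
Qed.

Lemma clt0_ptE x y : uw_turn x = 0 -> uw_turn y = 0 ->
  clt0 (uw_pt x) (uw_pt y) = (x < y).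
Proof. by case: x y => [m a] [n b] /= -> ->; rewrite ltUE ltxx eqxx. Qed.

(** Among the [n] consecutive elements starting at [X 1] there is a multiple of [n]. They do not
    pass [X n], since the [X i] increase by at least [eps] at each step. *)
Lemma presburger_regular : c_regular K.
Proof.
move=> n n1 x hx; pose X i := uw_lift (x i).
have eps0 := pres_eps_gt0.
have s_nth i : (i <= n)%N -> (0 < i)%N ->
    (0 :: [seq x i | i <- iota 1 n])`_i = x i.
  case: i => // i i_n _ /=.
  by rewrite (nth_map 0%N) ?size_iota // nth_iota // add1n.
have X_lt i j : (0 < i < j)%N -> (j <= n)%N -> X i < X j.
  move=> /andP[i0 ij] jn; rewrite -clt0_ptE // /clt0.
  have := hx 0%N i j; rewrite /= ?size_map ?size_iota i0 ij ltnS jn.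
  rewrite -![_`_j]/((0 :: [seq x i | i <- iota 1 n])`_j).
  by rewrite !s_nth ?(leq_trans i0 (ltnW ij)) // ?(leq_trans (ltnW ij)) // => ->.
have X1 : 0 < X 1%N.
  rewrite -clt0_ptE // /clt0 /= eqxx.
  have := hx 0%N 1%N n; rewrite /= ?size_map ?size_iota n1 ltnS leqnn.
  rewrite -(s_nth 1%N (ltnW n1)) // => /(_ isT isT) /cyc_neq[].
  by rewrite eq_sym => ->; rewrite orbT.
have X_ge i : (i < n)%N -> X 1%N + eps *+ i <= X i.+1.
  elim: i => [|i IH] i_n; first by rewrite addr0.
  rewrite -leU_subr (_ : _ - _ = (X i.+2 - X i.+1 - eps) +
    (X i.+1 - (X 1%N + eps *+ i))); last by zmod.
  apply: addU_ge0; rewrite leU_subr; last by rewrite IH 1?ltnW.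
  by apply: pres_eps_le; rewrite ltU_subr X_lt //= ltnSn.
(* As [r] is at most [n.-1], removing it from the dividend leaves [y *+ n] at or above [X 1]. *)
have [y [r [rn yE]]] := pres_edivn (X 1%N + eps *+ n.-1) (ltnW n1).
have y1 : X 1%N <= y *+ n.
  rewrite -leU_subr.
  have -> : y *+ n - X 1%N = eps *+ (n.-1 - r).
    have -> : y *+ n = X 1%N + eps *+ n.-1 - eps *+ r by rewrite yE; zmod.
    by rewrite mulrnBr; [zmod|lia].
  by apply/mulUn_ge0/ltW.
have yn : y *+ n <= X n.
  apply: le_trans (_ : X 1%N + eps *+ n.-1 <= _).
    rewrite yE -leU_subr (_ : _ - _ = eps *+ r); last by zmod.
    exact/mulUn_ge0/ltW.
  by have := X_ge n.-1; rewrite prednK ?(ltnW n1) //; apply; lia.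
have y0 : 0 < y.
  rewrite -(ltU_pMz2r _ _ (_ : 0 < n%:Z)); last by lia.
  by rewrite mul0rz; apply: lt_le_trans y1.
have y_lt i j : (i < j)%N -> y *+ i < y *+ j.
  by move=> ij; rewrite -ltU_subr -mulrnBr 1?ltnW // mulUn_gt0 // subn_gt0.
have y_turn i : (i <= n)%N -> uw_turn (y *+ i) = 0.
  move=> i_n; apply/eqP; rewrite -uw_ltz mulUn_ge0 ?ltW //=.
  apply: (@le_lt_trans _ _ (X n)); last by rewrite ltUE.
  apply: le_trans yn; rewrite -leU_subr -mulrnBr //.
  exact/mulUn_ge0/ltW.
exists (uw_pt y).
  rewrite -uw_ptMn; move: y1 yn; rewrite !le_eqVlt.
  case/orP=> [/eqP <-|y1]; first by constructor 1.
  case/orP=> [/eqP ->|yn]; first by constructor 2.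
  by constructor 3; apply: clt0_cyc; rewrite -[x _]/(uw_pt (X _)) clt0_ptE ?y_turn.
apply: cyc_seq_incr => i j; rewrite size_rcons size_map size_iota ltnS => /andP[ij].
have h k : (k < n)%N -> (rcons [seq uw_pt y *+ i | i <- iota 0 n] (x n))`_k =
    uw_pt (y *+ k).
  move=> kn; rewrite nth_rcons size_map size_iota kn (nth_map 0%N) ?size_iota //.
  by rewrite nth_iota // uw_ptMn.
rewrite leq_eqVlt => /orP[/eqP jn|jn].
  rewrite {j}jn in ij *; rewrite h // nth_rcons size_map size_iota ltnn eqxx.
  rewrite -[x _]/(uw_pt (X _)) clt0_ptE ?y_turn 1?ltnW //.
  exact: lt_le_trans (y_lt _ _ ij) yn.
have i_n := ltn_trans ij jn.
by rewrite !h // clt0_ptE ?y_turn 1?ltnW // y_lt.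
Qed.

End PresburgerRegular.

(** A nonzero element of the linear part lifts, up to sign, to a positive element of [max_convex].
    That element bounds [eps], so by convexity all multiples of [eps] lie in [max_convex], hence
    below [z]. *)
Lemma lin_part_unit_inf (G : cogroupType) (e : G) :
  e != 0 -> (forall a, a != 0 -> a = e \/ cyc 0 e a) -> ~ c_archimedean G ->
  forall k : int, uw_lift e *~ k < uw_z G.
Proof.
move=> e0 e_min /existsNP[a /not_implyP[/lin_partP[x Cx <-]]] x0.
have [cC C1] := max_convex_proper G.
have zC := proper_convex_z (max_convex_proper G).
have eC : max_convex (uw_lift e).
  wlog xp : x Cx x0 / 0 < x => [hw|].
    have [xn|xp|xx] := ltgtP x 0; [|exact: (hw x)|by rewrite xx in x0].
    apply: (hw (- x)); first exact: max_convexN.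
      by rewrite uw_ptN => /eqP; rewrite oppr_eq0 => /eqP.
    by rewrite -sub0r ltU_subr.
  have := eps_le e_min xp; rewrite le_eqVlt => /orP[/eqP->//|ex].
  case: cC => C0 _; apply; [exact: C0|exact: Cx| |exact: ex].
  exact: eps_gt0.
move=> k; apply: max_convex_lt uw_z_gt0 zC.
case: k => n; [|rewrite NegzE mulrNz; apply: max_convexN]; rewrite -pmulrn.
  elim: n => [|n IH]; first by case: cC.
  by rewrite mulrS; apply: max_convexD.
elim: n => [//|n IH].
by rewrite mulrS; apply: max_convexD.
Qed.

(** * The pure hull of the least element *)

Section PureHull.
Variables (G : cogroupType) (e : G).
Hypothesis pG : presburger e.

Definition pure_hull : {pred G} :=
  [pred a | `[< exists n (k : int), (0 < n)%N /\ a *+ n = e *~ k >]].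

Lemma pure_hullP a :
  reflect (exists n (k : int), (0 < n)%N /\ a *+ n = e *~ k) (a \in pure_hull).
Proof. exact: asboolP. Qed.

Fact pure_hull_closed : zmod_closed pure_hull.
Proof.
split=> [|a b /pure_hullP[m [j [m0 aE]]] /pure_hullP[n [k [n0 bE]]]].
  by apply/pure_hullP; exists 1%N, 0.
apply/pure_hullP; exists (m * n)%N, (j * n%:Z - k * m%:Z).
rewrite muln_gt0 m0 n0; split=> //.
have -> : (a - b) *+ (m * n) = (a *+ m) *+ n - (b *+ n) *+ m by zmod.
by rewrite aE bE; zmod.
Qed.

HB.instance Definition _ :=
  GRing.isZmodClosed.Build G pure_hull pure_hull_closed.

(** The hull contains every root in [G] of its elements, so the given [g] is itself the witness. *)
Lemma pure_hull_pure : pure_subgroup pure_hull.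
Proof.
move=> n h n0 /pure_hullP[m [k [m0 hE]]] [g gE]; exists g => //.
apply/pure_hullP; exists (n * m)%N, k; rewrite muln_gt0 n0 m0; split=> //.
by rewrite mulrnA gE.
Qed.

Local Notation H := (subco pure_hull).

Fact unit_in_hull : e \in pure_hull.
Proof. by apply/pure_hullP; exists 1%N, 1. Qed.

Definition hull_unit : H := SubCO unit_in_hull.

Lemma hull_discrete : discrete_co H.
Proof.
right; exists hull_unit => [|x x0].
  by rewrite -(inj_eq val_inj) /= (pres_neq0 pG).
rewrite -(inj_eq val_inj) in x0; have [xe|] := pres_min pG x0; last by right.
by left; apply: val_inj.
Qed.

Lemma hull_torsion (x : H) :
  exists n (k : int), (0 < n)%N /\ x *+ n = hull_unit *~ k.
Proof.
have /pure_hullP[n [k [n0 xE]]] := valP x; exists n, k; split=> //.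
by apply: val_inj; rewrite raddfMn raddfMz.
Qed.

Definition uw_val (x : unwound H) : unwound G := Unwound (uw_turn x) (val (uw_pt x)).

Lemma uw_val_lt x y : (uw_val x < uw_val y) = (x < y).
Proof. by []. Qed.

Lemma uw_val_inj : injective uw_val.
Proof. by case=> [m a] [n b] [-> /val_inj ->]. Qed.

Lemma uw_eta (y : unwound G) : Unwound (uw_turn y) (uw_pt y) = y.
Proof. by case: y. Qed.

Fact uw_val_additive : additive uw_val.
Proof.
have uw_valD x y : uw_val (x + y) = uw_val x + uw_val y.
  by case: x y => [m a] [n b]; rewrite uw_addUE /uw_val uw_addUE.
by move=> x y; apply: (addIr (uw_val y)); rewrite -uw_valD !subrK.
Qed.

HB.instance Definition _ :=
  GRing.isZmodMorphism.Build (unwound H) (unwound G) uw_val uw_val_additive.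

Lemma hull_presburger : presburger hull_unit.
Proof.
split.
- by rewrite -(inj_eq val_inj) /= (pres_neq0 pG).
- move=> a a0; rewrite -(inj_eq val_inj) in a0.
  by have [ae|] := pres_min pG a0; [left; apply: val_inj|right].
- by move=> k; rewrite -uw_val_lt raddfMz; apply: (pres_inf pG).
move=> n x n0; have [y [r yE]] := pres_div pG (uw_val x) n0.
(* The quotient found in [G] stays in the hull: [n] times its point differs from an element of the
   hull by a multiple of [e]. *)
have yH : uw_pt y \in pure_hull.
  have [m [k [m0 hE]]] := hull_torsion (uw_pt x).
  apply/pure_hullP; exists (n * m)%N, (k - r * m%:Z); rewrite muln_gt0 n0 m0; split=> //.
  have := congr1 (@uw_pt G) yE; rewrite uw_ptD uw_ptMn uw_ptMz /= => xE.
  have -> : uw_pt y *+ (n * m) = (uw_pt y *+ n + e *~ r) *+ m - e *~ (r * m%:Z) by zmod.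
  rewrite -xE; have := congr1 val hE; rewrite raddfMn raddfMz /= => ->.
  by zmod.
exists (Unwound (uw_turn y) (SubCO yH)), r; apply: uw_val_inj.
rewrite raddfD raddfMn raddfMz yE; congr (_ *+ _ + _).
by rewrite -[LHS]uw_eta.
Qed.

End PureHull.

(** * Quantifier elimination *)

Section LinearForms.
Variable V : zmodType.
Implicit Types (E : nat -> V) (p q : {poly int}).

(* The coefficient of ['X^i] is that of the variable [i]. *)
Definition lin_eval E p : V := \sum_(i < size p) E i *~ p`_i.

Lemma lin_evalE n E p : (size p <= n)%N ->
  lin_eval E p = \sum_(i < n) E i *~ p`_i.
Proof.
move=> pn; rewrite /lin_eval (big_ord_widen n (fun i => E i *~ p`_i) pn).
rewrite big_mkcond /=; apply: eq_bigr => i _; case: ltnP => // ip.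
by rewrite nth_default.
Qed.

Fact lin_eval_additive E : additive (lin_eval E).
Proof.
move=> p q; pose n := maxn (size p) (size q).
rewrite !(@lin_evalE n) ?leq_maxl ?leq_maxr //; last first.
  by rewrite (leq_trans (size_polyD _ _)) // size_polyN.
by rewrite -sumrB; apply: eq_bigr => i _; rewrite coefB mulrzBr.
Qed.

HB.instance Definition _ E :=
  GRing.isZmodMorphism.Build {poly int} V (lin_eval E) (lin_eval_additive E).

Lemma lin_evalXn E i : lin_eval E 'X^i = E i.
Proof.
rewrite /lin_eval size_polyXn big_ord_recr /= coefXn eqxx big1 ?add0r // => j _.
by rewrite coefXn ltn_eqF.
Qed.

Lemma lin_evalC E (k : int) : lin_eval E k%:P = E 0%N *~ k.
Proof.
by rewrite -[X in X%:P]intz rmorph_int -(expr0 'X) raddfMz /= lin_evalXn.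
Qed.

Definition upd E i a j := if j == i then a else E j.

(** The variable [i] is isolated: the first summand does not involve it. *)
Lemma lin_eval_upd E i a p :
  lin_eval (upd E i a) p = lin_eval E (p - 'X^i *~ p`_i) + a *~ p`_i.
Proof.
rewrite raddfB raddfMz /= lin_evalXn; pose n := maxn (size p) i.+1.
have i_n : (i < n)%N by rewrite leq_maxr.
rewrite !(@lin_evalE n) ?leq_maxl // (bigD1 (Ordinal i_n)) //=.
rewrite [in RHS](bigD1 (Ordinal i_n)) //= /upd eqxx.
rewrite (eq_bigr (fun j : 'I_n => E j *~ p`_j)) => [|j]; first by zmod.
by rewrite -val_eqE /= => /negbTE ->.
Qed.

End LinearForms.

Lemma seq_argmax (T : eqType) d (V : orderType d) (f : T -> V) (P : pred T) s :
  has P s -> exists t, [/\ t \in s, P t & forall u, u \in s -> P u -> (f u <= f t)%O].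
Proof.
elim: s => //= a s IH; have [/IH[t [ts Pt tmax]] _|sP] := boolP (has P s).
  have [/andP[Pa ta]|na] := boolP (P a && (f t <= f a)%O).
    exists a; split; rewrite ?mem_head // => u; rewrite inE => /orP[/eqP->//|us Pu].
    exact: le_trans (tmax u us Pu) ta.
  exists t; split; rewrite ?inE ?ts ?orbT // => u /orP[/eqP-> Pa|]; last exact: tmax.
  by move: na; rewrite Pa /= -ltNge => /ltW.
rewrite orbF => Pa; exists a; split; rewrite ?mem_head // => u.
rewrite inE => /orP[/eqP->//|us Pu]; case/hasP: sP; by exists u.
Qed.

(** The residue is one standard integer [r], which makes residues comparable across two different
    groups. *)
Definition congr_res (K K' : cogroupType) (e : K) (e' : K') (M : nat) x x' :=
  exists (r : int) y y',
    x = y *+ M + uw_lift e *~ r /\ x' = y' *+ M + uw_lift e' *~ r.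

(** * Placing a point with prescribed residue among finitely many values *)

Section Place.
Variables (K K' : cogroupType) (e : K) (e' : K').
Hypotheses (pK : presburger e) (pK' : presburger e').
Variables (T : eqType) (s : seq T) (v : T -> unwound K) (v' : T -> unwound K').
Variable D : nat.
Hypothesis D0 : (0 < D)%N.
Local Notation eps := (uw_lift e).
Local Notation eps' := (uw_lift e').
Hypothesis v_sgn : forall t u (k : int), t \in s -> u \in s -> `|k| <= (D + D)%:Z ->
  (v u < v t + eps *~ k) = (v' u < v' t + eps' *~ k).
Hypothesis v_res : forall t, t \in s -> congr_res e e' D (v t) (v' t).

(* [y'] is found just above the counterpart of the largest [v t] below
   [y *+ D + eps *~ s0], or just below all the [v' t] if there is none. *)
Lemma presburger_place (s0 : int) (y : unwound K) :
  exists y' : unwound K', forall t, t \in s ->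
    (v t < y *+ D + eps *~ s0) = (v' t < y' *+ D + eps' *~ s0) /\
    (y *+ D + eps *~ s0 < v t) = (y' *+ D + eps' *~ s0 < v' t).
Proof.
have eps0 := pres_eps_gt0 pK; have eps0' := pres_eps_gt0 pK'.
have v_lt t u : t \in s -> u \in s -> (v u < v t) = (v' u < v' t).
  by move=> ts us; have := v_sgn ts us (k := 0); rewrite !mulr0z !addr0; apply.
have [A AE0] : exists A, A = y *+ D + eps *~ s0 by exists (y *+ D + eps *~ s0).
rewrite -AE0.
have [|nA] := boolP (has (fun t => v t <= A) s).
  case/(seq_argmax v) => t0 [t0s t0A t0max].
  have [r [w [w' [wE wE']]]] := v_res t0s.
  have Dz : D%:Z != 0 by lia.
  have hk := divz_eq (s0 - r) D; have k0 := modz_ge0 (s0 - r) Dz.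
  have kD : ((s0 - r) %% D)%Z < D by apply: ltz_pmod.
  move: ((s0 - r) %/ D)%Z ((s0 - r) %% D)%Z hk k0 kD => q k hk k0 kD.
  have s0E : s0 = q * D%:Z + k + r by rewrite -hk subrK.
  (* Relative to [v t0], the residue of the target modulo [D] is [k]; only the quotient [u] has no
     counterpart on the other side. *)
  have [u AE] : exists u, A = v t0 + u *+ D + eps *~ k.
    by exists (y - w + eps *~ q); rewrite AE0 wE s0E; zmod.
  have u0 : 0 <= u.
    rewrite leNgt; apply/negP => u0; move: t0A; rewrite leNgt -ltU_subr.
    have -> : v t0 - A = eps *~ (D%:Z - k) + (- u - eps) *+ D by rewrite AE; zmod.
    rewrite addU_gt0 ?mulUz_gt0 ?subr_gt0 // mulUn_ge0 // leU_subr.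
    by apply: pres_eps_le => //; rewrite -sub0r ltU_subr.
  have BE (d : int) : (w' + eps' *~ (d - q)) *+ D + eps' *~ s0 =
      v' t0 + eps' *~ (k + d * D%:Z) by rewrite wE' s0E; zmod.
  (* If [u = 0], the target is at the standard distance [k] from [v t0], and the same distance is
     copied above [v' t0]. *)
  have [u00|un0] := eqVneq u 0.
    exists (w' + eps' *~ (0 - q)) => t ts; rewrite BE mul0r addr0.
    have {}AE : A = v t0 + eps *~ k by rewrite AE u00 mul0rn addr0.
    have kDD : `|k| <= (D + D)%:Z by lia.
    have kDD' : `|- k| <= (D + D)%:Z by lia.
    split; first by rewrite AE; apply: v_sgn.
    have := v_sgn ts t0s kDD'.
    rewrite -ltU_subr -[in X in _ = X -> _]ltU_subr.
    have -> : v t + eps *~ - k - v t0 = v t - A by rewrite AE; zmod.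
    rewrite ltU_subr => ->.
    have -> : v' t + eps' *~ - k - v' t0 = v' t - (v' t0 + eps' *~ k) by zmod.
    by rewrite ltU_subr.
  (* If [u > 0], the target is at least [k + D] steps above [v t0], and exactly that many are taken
     above [v' t0]. Adding [D] keeps the point strictly above [v' t0] even when [k = 0]; since
     [k < D], the signs assumed up to [D + D] suffice. *)
  have k'D : `|k + 1 * D%:Z| <= (D + D)%:Z by lia.
  exists (w' + eps' *~ (1 - q)) => t ts; rewrite BE.
  have v'B : v' t0 < v' t0 + eps' *~ (k + 1 * D%:Z).
    rewrite -ltU_subr (_ : _ - _ = eps' *~ (k + 1 * D%:Z)); last by zmod.
    by rewrite mulUz_gt0 //; lia.
  have vA : v t0 + eps *~ (k + 1 * D%:Z) <= A.
    rewrite -leU_subr AE (_ : _ - _ = (u - eps) *+ D); last by zmod.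
    rewrite mulUn_ge0 // leU_subr; apply: pres_eps_le => //.
    by rewrite lt_def un0.
  have v0A : v t0 < A.
    apply: lt_le_trans vA.
    rewrite -ltU_subr (_ : _ - _ = eps *~ (k + 1 * D%:Z)); last by zmod.
    by rewrite mulUz_gt0 //; lia.
  have [tA|At] := leP (v t) A.
    have tt0 := t0max t ts tA.
    have tt0' : v' t <= v' t0 by rewrite leNgt -v_lt // -leNgt.
    rewrite (le_lt_trans tt0 v0A) (le_lt_trans tt0' v'B); split=> //.
    by apply/esym/negbTE; rewrite -leNgt ltW // (le_lt_trans tt0' v'B).
  have Bt : v' t0 + eps' *~ (k + 1 * D%:Z) < v' t.
    have := le_lt_trans vA At; rewrite -ltU_subr.
    have kDD' : `|- (k + 1 * D%:Z)| <= (D + D)%:Z by rewrite normrN.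
    have -> : v t - (v t0 + eps *~ (k + 1 * D%:Z)) =
      v t + eps *~ - (k + 1 * D%:Z) - v t0 by zmod.
    rewrite ltU_subr (v_sgn ts t0s kDD') -ltU_subr.
    have -> : v' t + eps' *~ - (k + 1 * D%:Z) - v' t0 =
      v' t - (v' t0 + eps' *~ (k + 1 * D%:Z)) by zmod.
    by rewrite ltU_subr.
  by rewrite Bt; split=> //; rewrite !ltNge !ltW.
have {}nA t : t \in s -> A < v t.
  by move=> ts; rewrite ltNge; apply: contra nA => tA; apply/hasP; exists t.
have [hs|ns] := boolP (has predT s); last first.
  by exists 0 => t ts; case/hasP: ns; exists t.
(* Every value is above the target: [t0] is chosen with [v t0] least, and the new point is [k + D]
   steps below [v' t0]. *)
have [t0 [t0s _ t0min]] := seq_argmax (fun t => - v t) hs.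
have [r [w [w' [wE wE']]]] := v_res t0s.
have Dz : D%:Z != 0 by lia.
have hk := divz_eq (r - s0) D; have k0 := modz_ge0 (r - s0) Dz.
move: ((r - s0) %/ D)%Z ((r - s0) %% D)%Z hk k0 => q k hk k0.
exists (w' + eps' *~ (q - 1)) => t ts.
have s0E : s0 = r - (q * D%:Z + k) by rewrite -hk; ring.
have Bt : (w' + eps' *~ (q - 1)) *+ D + eps' *~ s0 < v' t.
  apply: (@lt_le_trans _ _ (v' t0)).
    rewrite -ltU_subr wE' s0E (_ : _ - _ = eps' *~ (k + D%:Z)); last by zmod.
    by rewrite mulUz_gt0 //; lia.
  rewrite leNgt -v_lt // -leNgt.
  have := t0min t ts isT; rewrite -leU_subr (_ : _ - _ = v t - v t0); last by zmod.
  by rewrite leU_subr.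
have At := nA t ts.
by rewrite Bt At; split=> //; rewrite !ltNge !ltW.
Qed.

End Place.

Definition int_range (n : nat) : seq int :=
  [seq j%:Z - n%:Z | j <- iota 0 (n + n).+1].

Lemma mem_int_range n k : (k \in int_range n) = (`|k| <= n%:Z).
Proof.
apply/mapP/idP => [[j]|kn]; first by rewrite mem_iota => ? ->; lia.
by exists (absz (k + n%:Z)); rewrite ?mem_iota; lia.
Qed.

(** The product of the absolute values of the nonzero coefficients at [i] works; it gives the
    variable [i] the same coefficient [N] in all forms. *)
Lemma common_multiple (L : seq {poly int}) i :
  exists2 N : nat, (0 < N)%N &
    forall p : {poly int}, p \in L -> p`_i != 0 -> (p`_i * (N%:Z %/ p`_i)%Z = N%:Z).
Proof.
suff [N N0 hN] : exists2 N : nat, (0 < N)%N &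
    forall p : {poly int}, p \in L -> p`_i != 0 -> (p`_i %| N%:Z)%Z.
  by exists N => // p pL p0; rewrite mulrC divzK ?hN.
elim: L => [|q L [N N0 IH]]; first by exists 1%N.
have [q0|q0] := eqVneq q`_i 0.
  exists N => // p; rewrite inE => /orP[/eqP-> /eqP[]//|]; exact: IH.
exists (N * absz (q`_i)%R)%N; first by rewrite muln_gt0 N0 lt0n absz_eq0.
move=> p; rewrite inE PoszM => /orP[/eqP-> _|pL p0].
  by apply: dvdz_mull; rewrite dvdzE absz_nat.
by apply: dvdz_mulr; apply: IH.
Qed.

Section Similarity.
Variables (K K' : cogroupType) (e : K) (e' : K').

Definition sim (L : seq {poly int}) (M : nat) (E : nat -> unwound K)
  (E' : nat -> unwound K') : Prop :=
  (forall p, p \in L -> (0 < lin_eval E p) = (0 < lin_eval E' p)) /\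
  (forall i, congr_res e e' M (E i) (E' i)).

Lemma congr_res_lin M E E' p : (forall i, congr_res e e' M (E i) (E' i)) ->
  congr_res e e' M (lin_eval E p) (lin_eval E' p).
Proof.
move=> EE'; rewrite /lin_eval; apply: (big_ind2 (congr_res e e' M)).
- by exists 0, 0, 0; split; zmod.
- move=> _ _ _ _ [r [y [y' [-> ->]]]] [s [w [w' [-> ->]]]].
  by exists (r + s), (y + w), (y' + w'); split; zmod.
- move=> i _; have [r [y [y' [-> ->]]]] := EE' i.
  by exists (r * p`_i), (y *~ p`_i), (y' *~ p`_i); split; zmod.
Qed.

End Similarity.

Lemma sim_sym (K K' : cogroupType) (e : K) (e' : K') L M E E' :
  sim e e' L M E E' -> sim e' e L M E' E.
Proof.
move=> [sL sM]; split=> [p /sL->//|i]; have [r [y [y' [? ?]]]] := sM i.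
by exists r, y', y.
Qed.

(* Cooper's elimination of a quantifier, as a back-and-forth step. *)
Lemma sim_step (L : seq {poly int}) (M i : nat) : (0 < M)%N -> i != 0%N ->
  exists (L' : seq {poly int}) (M' : nat), (0 < M')%N /\
  forall (K K' : cogroupType) (e : K) (e' : K') E E',
    presburger e -> presburger e' ->
    E 0%N = uw_lift e -> E' 0%N = uw_lift e' -> sim e e' L' M' E E' ->
    forall a, exists b, sim e e' L M (upd E i a) (upd E' i b).
Proof.
move=> M0 i0; have [N N0 hN] := common_multiple L i.
pose rest (p : {poly int}) := p - 'X^i *~ p`_i.
pose bound p := rest p *~ - (N%:Z %/ p`_i)%Z.
(* If [a] is [y *+ M] plus [r] units, then [N] times [a] is [y *+ D] plus [r * N] units. Placing it
   modulo [D] with this offset yields a point still divisible by [N]. *)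
pose D := (N * M)%N; have D0 : (0 < D)%N by rewrite muln_gt0 N0.
(* The forms [rest p] handle those without the variable; the shifted differences of bounds are the
   comparisons needed for the placement. *)
exists ([seq rest p | p <- L] ++
  [seq tu.1 - tu.2 + k%:P | tu <- [seq (t, u) | t <- map bound L, u <- map bound L],
                            k <- int_range (D + D)]), D.
split=> // K K' e e' E E' pK pK' E0 E0' [sL sM] a.
have [y [r aE]] := pres_div pK a M0.
pose T := map bound L.
have sT t u (k : int) : t \in T -> u \in T -> `|k| <= (D + D)%:Z ->
    (lin_eval E u < lin_eval E t + uw_lift e *~ k) =
    (lin_eval E' u < lin_eval E' t + uw_lift e' *~ k).
  move=> tT uT kD; rewrite -ltU_subr -[RHS]ltU_subr.
  have -> : lin_eval E t + uw_lift e *~ k - lin_eval E u =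
    lin_eval E (t - u + k%:P) by rewrite raddfD raddfB /= lin_evalC E0; zmod.
  have -> : lin_eval E' t + uw_lift e' *~ k - lin_eval E' u =
    lin_eval E' (t - u + k%:P) by rewrite raddfD raddfB /= lin_evalC E0'; zmod.
  apply: sL; rewrite mem_cat; apply/orP; right.
  apply/allpairsP; exists ((t, u), k); split=> //.
    by apply/allpairsP; exists (t, u).
  by rewrite mem_int_range.
have rT t : t \in T -> congr_res e e' D (lin_eval E t) (lin_eval E' t).
  by move=> _; apply: congr_res_lin.
have [y' hy] := presburger_place pK pK' D0 sT rT (r * N%:Z) y.
exists (y' *+ M + uw_lift e' *~ r); split=> [p pL|j]; last first.
  rewrite /upd; case: eqP => _; first by exists r, y, y'; rewrite aE.
  have [s [w [w' [-> ->]]]] := sM j.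
  by exists s, (w *+ N), (w' *+ N); rewrite -!mulrnA.
rewrite !lin_eval_upd -/(rest p); have [p0|p0] := eqVneq p`_i 0.
  have := sL (rest p); rewrite mem_cat map_f // /rest p0 => /(_ isT).
  by rewrite !mulr0z !addr0.
have [h1 h2] := hy (bound p) (map_f _ pL).
have cN := hN p pL p0.
move: h1 h2; rewrite /bound !raddfMz /=.
move: (lin_eval E (rest p)) (lin_eval E' (rest p)) => x x'.
move: cN p0; rewrite aE; move: (p`_i) ((N : int) %/ p`_i)%Z => c d cN c0.
have AE (V : zmodType) (v w : V) :
    v *+ D + w *~ (r * N%:Z) = (v *+ M + w *~ r) *~ (c * d).
  by rewrite cN /D; zmod.
rewrite !AE; move: (y *+ M + _) (y' *+ M + _) => A A' h1 h2.
(* A negative [d] turns the bound into an upper one, so the scaling is by [- d]. *)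
have [d0|d0|d0] := ltgtP d 0; last by move: cN; rewrite d0 mulr0; lia.
  have d0' : 0 < - d by rewrite oppr_gt0.
  rewrite -(ltU_pMz2r _ _ d0') -[RHS](ltU_pMz2r _ _ d0') !mul0rz.
  have -> : (x + A *~ c) *~ - d = x *~ - d - A *~ (c * d) by zmod.
  have -> : (x' + A' *~ c) *~ - d = x' *~ - d - A' *~ (c * d) by zmod.
  by rewrite !ltU_subr.
rewrite -(ltU_pMz2r _ _ d0) -[RHS](ltU_pMz2r _ _ d0) !mul0rz.
have -> : (x + A *~ c) *~ d = A *~ (c * d) - x *~ - d by zmod.
have -> : (x' + A' *~ c) *~ d = A' *~ (c * d) - x' *~ - d by zmod.
by rewrite !ltU_subr.
Qed.

(** * Elementarity of the pure hull *)

(** Among the three cyclically consecutive pairs at most one is a descent for the order cut at 0: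
    two adjacent descents would give the opposite orientation. Atoms thus reduce to [clt0]. *)
Lemma cyc_clt0 (K : cogroupType) (a b c : K) :
  cyc a b c = [|| clt0 a b && clt0 b c, clt0 b c && clt0 c a | clt0 c a && clt0 a b].
Proof.
apply/idP/or3P => [abc|]; last first.
  case=> /andP[h1 h2]; first exact: clt0_cyc h2.
    by do 2!apply: cyc_rot; apply: clt0_cyc h2.
  by apply: cyc_rot; apply: clt0_cyc h2.
have [ab bc ac] := cyc_neq abc.
have no (x y u : K) : cyc x y u -> clt0 y x -> clt0 u y -> False.
  by move=> h yx uy; have := clt0_cyc uy yx => /cyc_rot/cyc_rot/cyc_asym; rewrite h.
have bca := cyc_rot abc; have cab := cyc_rot bca.
case/orP: (clt0_total ab) => h1; case/orP: (clt0_total bc) => h2.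
- by constructor 1; rewrite h1.
- case/orP: (clt0_total ac) => h3; last by constructor 3; rewrite h3.
  by case: (no _ _ _ bca).
- case/orP: (clt0_total ac) => h3; last by constructor 2; rewrite h2.
  by case: (no _ _ _ cab).
- by case: (no _ _ _ abc).
Qed.

Lemma eq_clt0 (K : cogroupType) (a b : K) : (a == b) = ~~ clt0 a b && ~~ clt0 b a.
Proof.
have [->|/clt0_total] := eqVneq a b; first by rewrite clt0_irr.
by case/orP=> ->; rewrite ?andbF.
Qed.

(** * Terms as linear forms on the unwound *)

Fixpoint co_form (t : co_term) : {poly int} :=
  match t with
  | co_var i => 'X^(i.+2)
  | co_zero => 0
  | co_opp t1 => - co_form t1
  | co_add t1 t2 => co_form t1 + co_form t2
  end.

Fixpoint co_size (t : co_term) : nat :=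
  match t with
  | co_opp t1 => (co_size t1).+1
  | co_add t1 t2 => (co_size t1 + co_size t2).+1
  | _ => 0
  end.

Section Environment.
Variables (K : cogroupType) (e : K).
Implicit Types (v : nat -> K) (x y : unwound K).

(** Slots 0 and 1 hold the unit and [z], whence the shift by two in [co_form]. The unit serves as
    the constant 1, and multiples of [z] measure turns. *)
Definition uw_env v (j : nat) : unwound K :=
  match j with 0%N => uw_lift e | 1%N => uw_z K | i.+2 => uw_lift (v i) end.

Lemma uw_pt_form v t : uw_pt (lin_eval (uw_env v) (co_form t)) = co_eval v t.
Proof.
elim: t => [i||t IH|t1 IH1 t2 IH2] /=.
- by rewrite lin_evalXn.
- by rewrite raddf0.
- by rewrite raddfN uw_ptN IH.
- by rewrite raddfD uw_ptD IH1 IH2.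
Qed.

(** Each opposite or sum changes the turn by at most one beyond the expected value, and [co_size]
    counts these operations. *)
Lemma uw_turn_form v t :
  `|uw_turn (lin_eval (uw_env v) (co_form t))| <= (co_size t)%:Z.
Proof.
elim: t => [i||t IH|t1 IH1 t2 IH2] /=.
- by rewrite lin_evalXn.
- by rewrite raddf0.
- rewrite raddfN /=; move: IH; case: (lin_eval _ _) => m a /= IH.
  have -> : - Unwound m a = uw_opp (Unwound m a) by [].
  by rewrite /=; case: ifP => _ /=; lia.
- rewrite raddfD /=; move: IH1 IH2.
  move: (lin_eval _ (co_form t1)) (lin_eval _ (co_form t2)) => [m a] [n b] /=.
  by rewrite uw_addUE /=; case: (carry01 a b) => ->; lia.
Qed.

Lemma uw_env_upd v i a :
  upd (uw_env v) i.+2 (uw_lift a) = uw_env (upd v i a).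
Proof. by apply/funext => -[|[|j]] //; rewrite /upd /= !eqSS; case: eqP. Qed.

Lemma uw_lt_turn x (k : int) : (x < uw_z K *~ k) = (uw_turn x < k).
Proof.
have := uw_turnDz (0 : unwound K) k; rewrite !add0r; have := uw_ptz K k.
case: x => m a; case: (uw_z K *~ k) => n b /= -> ->.
by rewrite ltUE clt0x0 andbF orbF.
Qed.

Lemma uw_turn0E x : (uw_turn x == 0) = ~~ (0 < - x) && (0 < uw_z K - x).
Proof. by rewrite -uw_ltz ltU_subr -[- x]sub0r ltU_subr -leNgt. Qed.

(** Once their turns are removed, both elements lie between [0] and [z], where the cut order is the
    order of the unwound. *)
Lemma clt0_pt_turn x y : clt0 (uw_pt x) (uw_pt y) =
  (0 < y - x - uw_z K *~ (uw_turn y - uw_turn x)).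
Proof.
have red w : exists2 w0, uw_pt w0 = uw_pt w & uw_turn w0 = 0 /\ w0 = w - uw_z K *~ uw_turn w.
  exists (w - uw_z K *~ uw_turn w); first by rewrite uw_ptD uw_ptN uw_ptz subr0.
  by rewrite -{1}mulrNz uw_turnDz subrr.
have [x0 <- [x0t x0E]] := red x; have [y0 <- [y0t y0E]] := red y.
rewrite clt0_ptE // -ltU_subr; congr (0 < _); rewrite x0E y0E; zmod.
Qed.

End Environment.

(** The first two lists detect the turns of the values of [t] and [u]; the third compares their
    points for each possible difference of turns. *)
Definition atom_forms (t u : co_term) : seq {poly int} :=
  [seq 'X^1 *~ k - co_form t | k <- int_range (co_size t).+1] ++
  [seq 'X^1 *~ k - co_form u | k <- int_range (co_size u).+1] ++
  [seq co_form u - co_form t - 'X^1 *~ k | k <- int_range (co_size t + co_size u)].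

Lemma sim_weaken (K K' : cogroupType) (e : K) (e' : K') L L' M N E E' :
  {subset L' <= L} -> sim e e' L (N * M) E E' -> sim e e' L' M E E'.
Proof.
move=> LL' [sL sM]; split=> [p /LL'/sL//|i].
have [r [y [y' [-> ->]]]] := sM i.
by exists r, (y *+ N), (y' *+ N); rewrite -!mulrnA.
Qed.

Section Transfer.
Variables (K K' : cogroupType) (e : K) (e' : K').
Variables (v : nat -> K) (v' : nat -> K').
Local Notation E := (uw_env e v).
Local Notation E' := (uw_env e' v').

(** The turn lies in a bounded window, so finitely many comparisons with multiples of [z] determine
    it. The range exceeds the window by one because a turn [m] is recognized at [k = m] and
    [k = m + 1]. *)
Lemma sim_turn L M t : sim e e' L M E E' ->
  {subset [seq 'X^1 *~ k - co_form t | k <- int_range (co_size t).+1] <= L} ->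
  uw_turn (lin_eval E (co_form t)) = uw_turn (lin_eval E' (co_form t)).
Proof.
move=> [sL _] tL.
have := uw_turn_form e v t; have := uw_turn_form e' v' t.
have h (k : int) : `|k| <= (co_size t).+1%:Z ->
  (uw_turn (lin_eval E (co_form t)) < k) = (uw_turn (lin_eval E' (co_form t)) < k).
  move=> kt; have := sL ('X^1 *~ k - co_form t).
  rewrite !raddfB !raddfMz /= !lin_evalXn !ltU_subr !uw_lt_turn; apply.
  by apply: tL; apply/mapP; exists k; rewrite ?mem_int_range.
move: (uw_turn _) (uw_turn _) h => m n h nt mt.
have := h (m + 1); have := h m; have := h (n + 1); have := h n; lia.
Qed.

Lemma sim_clt0 L M t u : sim e e' L M E E' -> {subset atom_forms t u <= L} ->
  clt0 (co_eval v t) (co_eval v u) = clt0 (co_eval v' t) (co_eval v' u).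
Proof.
move=> s tuL; rewrite -!(uw_pt_form e) -!(uw_pt_form e') !clt0_pt_turn.
rewrite -(@sim_turn _ _ t s) => [|p pL]; last by apply: tuL; rewrite mem_cat pL.
rewrite -(@sim_turn _ _ u s) => [|p pL]; last first.
  by apply: tuL; rewrite !mem_cat pL orbT.
have := uw_turn_form e v t; have := uw_turn_form e v u.
move: (uw_turn _) (uw_turn _) => m n hm hn.
have [d dE] : exists d : int, d = n - m by exists (n - m).
rewrite -dE; have := s.1 (co_form u - co_form t - 'X^1 *~ d).
rewrite !raddfB !raddfMz /= !lin_evalXn; apply.
apply: tuL; rewrite !mem_cat; do 2!(apply/orP; right).
by apply/mapP; exists d; rewrite ?mem_int_range ?mulNrz //; lia.
Qed.

End Transfer.

(** Uniformity in both groups lets them be exchanged under a negation, so a single implication is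
    enough. *)
Definition transferred (phi : co_formula) (L : seq {poly int}) (M : nat) : Prop :=
  forall (K K' : cogroupType) (e : K) (e' : K') (v : nat -> K) (v' : nat -> K'),
    presburger e -> presburger e' ->
    sim e e' L M (uw_env e v) (uw_env e' v') -> co_sat v phi -> co_sat v' phi.

Lemma transfer phi : exists (L : seq {poly int}) (M : nat),
  (0 < M)%N /\ transferred phi L M.
Proof.
elim: phi => [t u|t u w|p [L [M [M0 IH]]]|
    p [L [M [M0 IHp]]] q [L' [M' [M0' IHq]]]|i p [L [M [M0 IH]]]].
- exists (atom_forms t u ++ atom_forms u t), 1%N; split=> // K K' e e' v v' pK pK' s /=.
  move=> /eqP; rewrite eq_clt0 => h; apply/eqP; rewrite eq_clt0; move: h.
  rewrite !(sim_clt0 s) //.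
    by move=> f; rewrite !mem_cat => ->; rewrite orbT.
  by move=> f; rewrite !mem_cat => ->.
- exists (atom_forms t u ++ atom_forms u w ++ atom_forms w t), 1%N.
  split=> // K K' e e' v v' pK pK' s /=.
  rewrite !cyc_clt0 !(sim_clt0 s) //;
    by move=> f; rewrite !mem_cat => ->; rewrite ?orbT.
- exists L, M; split=> // K K' e e' v v' pK pK' s /= h h'; apply: h.
  exact: IH pK' pK (sim_sym s) h'.
- exists (L ++ L'), (M' * M)%N; rewrite muln_gt0 M0 M0'.
  split=> // K K' e e' v v' pK pK' s /= [hp hq].
  split.
    apply: (IHp _ _ _ _ _ _ pK pK' _ hp).
    by apply: (sim_weaken (M := M) (N := M') _ s) => f fL; rewrite mem_cat fL.
  apply: (IHq _ _ _ _ _ _ pK pK' _ hq); rewrite mulnC in s.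
  apply: (sim_weaken (M := M') (N := M) _ s) => f fL.
  by rewrite mem_cat fL orbT.
(* A quantifier over the group is one over the interval from [0] to [z] of the unwound. The two
   added forms express membership in this interval, so the answer [b] is again a lift. *)
have [L' [M' [M0' step]]] :=
  sim_step ([:: - 'X^(i.+2), 'X^1 - 'X^(i.+2) & L]) M0 (isT : i.+2 != 0%N).
exists L', M'; split=> // K K' e e' v v' pK pK' s /= [a ha].
have [b hb] := step _ _ _ _ _ _ pK pK' erefl erefl s (uw_lift a).
have /eqP bt : uw_turn b == 0.
  have := hb.1 (- 'X^(i.+2)); have := hb.1 ('X^1 - 'X^(i.+2)).
  rewrite !inE !eqxx orbT => /(_ isT) + /(_ isT).
  rewrite !raddfB !raddfN /= !lin_evalXn /upd eqxx /= => h1 h2.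
  by rewrite uw_turn0E -h1 -h2 -uw_turn0E.
have bE : b = uw_lift (uw_pt b) by rewrite /uw_lift -bt uw_eta.
exists (uw_pt b).
apply: (IH _ _ _ _ _ _ pK pK' _ ha).
rewrite -/(upd v i a) -/(upd v' i (uw_pt b)) -!uw_env_upd -bE.
rewrite -(mul1n M) in hb; apply: (sim_weaken (M := M) (N := 1%N) _ hb) => f fL.
by rewrite !inE fL !orbT.
Qed.

Section Elementary.
Variables (G : cogroupType) (e : G).
Hypothesis pG : presburger e.
Local Notation H := (subco (pure_hull e)).

(** [uw_val] preserves linear forms and signs, and a division carried out in the hull gives the same
    residue in [G]. *)
Lemma hull_sim L M (v : nat -> H) : (0 < M)%N ->
  sim (hull_unit e) e L M (uw_env (hull_unit e) v) (uw_env e (fun i => val (v i))).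
Proof.
move=> M0.
have valE j : uw_env e (fun i => val (v i)) j = uw_val (uw_env (hull_unit e) v j).
  by case: j => [|[|j]].
split=> [p _|i].
  rewrite -(uw_val_lt 0) raddf0; congr (_ < _).
  rewrite /lin_eval raddf_sum; apply: eq_bigr => i _.
  by rewrite valE raddfMz.
have [y [r yE]] := pres_div (hull_presburger pG) (uw_env (hull_unit e) v i) M0.
by exists r, y, (uw_val y); rewrite valE yE raddfD raddfMn raddfMz.
Qed.

Lemma hull_elementary : elementary_subgroup (pure_hull e).
Proof.
move=> phi v; have [L [M [M0 h]]] := transfer phi.
have pH := hull_presburger pG; have s := hull_sim L v M0.
by split; [apply: h s|apply: h (sim_sym s)].
Qed.

End Elementary.

(** * The linear part *)

Section Torsion.
Variables (K : cogroupType) (e : K).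
Hypotheses (pK : presburger e)
  (K_torsion : forall x : K, exists n (k : int), (0 < n)%N /\ x *+ n = e *~ k).
Local Notation eps := (uw_lift e).
Local Notation z := (uw_z K).
Implicit Types (x y w : unwound K).

Lemma uw_torsion x :
  exists n (a b : int), (0 < n)%N /\ x *+ n = eps *~ a + z *~ b.
Proof.
have [n [k [n0 xk]]] := K_torsion (uw_pt x).
exists n, k, (uw_turn (x *+ n) - uw_turn (eps *~ k)); split=> //.
by apply: uw_eqz; rewrite uw_ptMn uw_ptMz.
Qed.

(** [z] dominates every multiple of [eps], so the coefficient of [z] decides the sign. *)
Lemma eps_z_gt0 (a b : int) : 0 < b -> 0 < eps *~ a + z *~ b.
Proof.
move=> b0; have -> : eps *~ a + z *~ b = z - eps *~ - a + z *~ (b - 1) by zmod.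
rewrite addU_gt0 ?ltU_subr ?(pres_inf pK) //.
by apply: mulUz_ge0; [exact/ltW/uw_z_gt0|lia].
Qed.

Lemma eps_z_inj (a b a' b' : int) :
  eps *~ a + z *~ b = eps *~ a' + z *~ b' -> b = b'.
Proof.
move=> h; have [bb|bb|//] := ltgtP b b'; exfalso.
  have := @eps_z_gt0 (a' - a) (b' - b); rewrite subr_gt0 => /(_ bb).
  have -> : eps *~ (a' - a) + z *~ (b' - b) =
    eps *~ a' + z *~ b' - (eps *~ a + z *~ b) by zmod.
  by rewrite h subrr ltxx.
have := @eps_z_gt0 (a - a') (b - b'); rewrite subr_gt0 => /(_ bb).
have -> : eps *~ (a - a') + z *~ (b - b') =
  eps *~ a + z *~ b - (eps *~ a' + z *~ b') by zmod.
by rewrite h subrr ltxx.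
Qed.

(** A nonnegative [x] is at most [x *+ n], hence lies in an interval where [eps_interval] leaves
    only multiples of [eps]. *)
Lemma mulUn_eps x n (a : int) : (0 < n)%N -> x *+ n = eps *~ a ->
  exists k : int, x = eps *~ k.
Proof.
move=> n0; wlog x0 : x a / 0 <= x => [hw|] xE.
  have [x0|x0] := leP (0 : unwound K) x; first exact: hw xE.
  have [||k kE] := hw (- x) (- a).
  - by rewrite -[- x]sub0r leU_subr ltW.
  - by rewrite mulNrn xE mulrNz.
  by exists (- k); rewrite mulrNz -kE opprK.
have xa : x <= eps *+ absz a.
  apply: le_trans (_ : x *+ n <= _).
    rewrite -leU_subr (_ : x *+ n - x = x *+ n.-1) ?mulUn_ge0 //.
    by rewrite -{1}(prednK n0); zmod.
  rewrite xE pmulrn -leU_subr -mulrzBr mulUz_ge0 //; last by lia.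
  exact/ltW/pres_eps_gt0.
by have [j _ ->] := eps_interval (pres_min pK) x0 xa; exists j.
Qed.

Lemma ltU_epsMz (m n : int) : (eps *~ m < eps *~ n) = (m < n).
Proof.
have h (k l : int) : k < l -> eps *~ k < eps *~ l.
  move=> kl; rewrite -ltU_subr -mulrzBr mulUz_gt0 ?subr_gt0 //.
  exact: pres_eps_gt0.
have [/h->//|/h nm|->] := ltgtP m n; last by rewrite ltxx.
by rewrite ltNge ltW.
Qed.

Lemma max_convex_eps x : max_convex x <-> exists k : int, x = eps *~ k.
Proof.
have epsC (k : int) : max_convex (eps *~ k).
  apply: (@max_convex_max _ [set y | exists k : int, y = eps *~ k]); last by exists k.
  split; [split|].
  - by exists 0.
  - by move=> y w [i ->] [j ->]; exists (i - j); rewrite mulrzBr.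
  - move=> _ y _ [i ->] [j ->] iy yj.
    have ij : i < j by rewrite -ltU_epsMz; exact: (@lt_trans _ _ y).
    have [||l _ lE] := @eps_interval _ _ (pres_min pK) (y - eps *~ i) (absz (j - i)).
    + by rewrite leU_subr; apply: ltW.
    + have ij0 : 0 <= j - i by rewrite subr_ge0 ltW.
      rewrite pmulrn gez0_abs // -leU_subr.
      by rewrite (_ : _ - _ = eps *~ j - y) ?leU_subr; [apply: ltW|zmod].
    by exists (i + l%:Z); rewrite mulrzDr -pmulrn -lE addrC subrK.
  - move=> /seteqP[_ /(_ z Logic.I)[l zk]].
    by have := pres_inf pK l; rewrite -zk ltxx.
split=> [Cx|[k ->]]; last exact: epsC.
have [n [a [b [n0 xE]]]] := uw_torsion x.
have [cC _] := max_convex_proper K; have zC := proper_convex_z (max_convex_proper K).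
have [b0|b0] := eqVneq b 0.
  by apply: (mulUn_eps n0 (a := a)); rewrite xE b0 mulr0z addr0.
exfalso.
have Cn y m : max_convex y -> max_convex (y *+ m).
  by move=> Cy; elim: m => [|m IH]; [case: cC|rewrite mulrS; apply: max_convexD].
wlog b1 : x a b Cx xE b0 / 0 < b => [hw|].
  have [b1|b1|bb] := ltgtP b 0; [|exact: (hw x a b)|by rewrite bb in b0].
  apply: (hw (- x) (- a) (- b)); rewrite ?oppr_eq0 ?oppr_gt0 //.
    exact: max_convexN.
  by rewrite mulNrn xE; zmod.
(* With [b > 0], the element [x *+ n + eps *~ (1 - a)] of [max_convex] is [eps + z *~ b], above [z];
   convexity would put [z] in [max_convex]. *)
apply: zC; case: cC => C0 _; apply; [exact: C0| |exact: uw_z_gt0|].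
  by apply: max_convexD; [apply: (Cn x n Cx)|apply: (epsC (1 - a))].
rewrite uw_lt_lt -ltU_subr xE (_ : _ - z = eps + z *~ (b - 1)); last by zmod.
rewrite addU_gt0 ?pres_eps_gt0 //.
by apply: mulUz_ge0; [exact/ltW/uw_z_gt0|lia].
Qed.

Fact unit_in_lin_part : e \in lin_part K.
Proof.
by apply/lin_partP; exists eps => //; apply/max_convex_eps; exists 1.
Qed.

Definition lin_unit : subco (lin_part K) := SubCO unit_in_lin_part.

Definition lin_iso (k : int) : subco (lin_part K) := lin_unit *~ k.

Fact lin_iso_additive : additive lin_iso.
Proof. by move=> k l; rewrite /lin_iso mulrzBr. Qed.

HB.instance Definition _ := GRing.isZmodMorphism.Build int
  (subco (lin_part K)) lin_iso lin_iso_additive.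

Lemma presburger_lin_part_isoZ : lin_part_isoZ K.
Proof.
have iso_pt k : val (lin_iso k) = uw_pt (eps *~ k).
  by rewrite /lin_iso raddfMz uw_ptMz.
have epsC k : max_convex (eps *~ k) by apply/max_convex_eps; exists k.
exists lin_iso; split=> [|m n]; last first.
  split=> [[x [y [Cx Cy xm yn]]]|mn].
    rewrite (max_convex_pt_inj Cx (epsC m)) ?xm //.
    by rewrite (max_convex_pt_inj Cy (epsC n)) ?yn // -ltU_epsMz.
  by exists (eps *~ m), (eps *~ n); split=> //; rewrite uw_lt_lt ltU_epsMz.
have inj : injective lin_iso.
  move=> m n /(congr1 val); rewrite !iso_pt => /(max_convex_pt_inj (epsC m) (epsC n)) h.
  by have [] := ltgtP m n; rewrite -?ltU_epsMz ?h ?ltxx.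
have surj a : exists k, lin_iso k = a.
  have [x /max_convex_eps[k ->] kE] := lin_partP _ (valP a).
  by exists k; apply: val_inj; rewrite iso_pt.
have [g gK] := choice surj.
by exists g => [k|//]; apply: inj.
Qed.

End Torsion.

(** * The embedding in the circle *)

Section Expi.
Variable R : realType.
Implicit Types s t q : R.

Lemma expiD s t : expi (s + t) = expi s * expi t.
Proof.
rewrite /expi sinD cosD; apply/eqP; rewrite eq_complex /=.
by rewrite eqxx addrC eqxx.
Qed.

Lemma expi0 : expi (0 : R) = 1.
Proof. by rewrite /expi cos0 sin0. Qed.

Lemma circle_expi t : circle (expi t).
Proof. by rewrite /circle /= normc_def /= cos2Dsin2 sqrtr1. Qed.

Lemma expi_neq0 t : expi t != 0.
Proof. by rewrite -normr_gt0 circle_expi ltr01. Qed.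

Lemma expi_2pi_int (k : int) : expi (2 * pi * k%:~R : R) = 1.
Proof.
have expi2pi : expi (2 * pi : R) = 1.
  by rewrite /expi mulr_natl cos2pi sin2pi.
have h n : expi (2 * pi * n%:R : R) = 1.
  elim: n => [|n IH]; first by rewrite mulr0 expi0.
  by rewrite -[n.+1]addn1 natrD mulrDr mulr1 expiD IH expi2pi mulr1.
case: k => n; first exact: h.
have := expiD (2 * pi * (Negz n)%:~R : R) (2 * pi * n.+1%:R).
rewrite h mulr1 => <-; rewrite NegzE -mulrDr mulrNz -pmulrn addNr mulr0.
exact: expi0.
Qed.

Lemma expi_eq1 t : 0 <= t < 2 * pi -> expi t = 1 -> t = 0.
Proof.
move=> /andP[t0 t2]; rewrite /expi => -[ct _].
have p0 := pi_gt0 R.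
have in0 : (0 : R) \in `[0, pi]%R by rewrite in_itv /= lexx ltW.
have [tp|pt] := leP t pi.
  by apply: cos_inj; rewrite ?cos0 // in_itv /= t0.
(* On the second half of the circle, cosine is injective in [2 * pi - t]; its vanishing contradicts
   [t < 2 * pi]. *)
have : 2 * pi - t = 0; last by lra.
apply: cos_inj => //; first by rewrite in_itv /=; apply/andP; split; lra.
by rewrite mulr_natl cosB cos2pi sin2pi mul1r mul0r addr0 cos0.
Qed.

Lemma expi_2piP q : expi (2 * pi * q) = 1 <-> exists k : int, q = k%:~R.
Proof.
split=> [h|[k ->]]; last exact: expi_2pi_int.
exists (Num.floor q); apply/eqP; rewrite -subr_eq0.
have p0 := pi_gt0 R; have p2 : 0 < 2 * pi :> R by rewrite mulr_gt0.
have := @expi_eq1 (2 * pi * (q - (Num.floor q)%:~R)).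
have /andP[f1 f2] := floor_itv q.
rewrite pmulr_rge0 // subr_ge0 f1 -[X in _ < X]mulr1 ltr_pM2l //= ltrBlDl.
rewrite -(intrD _ _ 1) f2 => /(_ isT) h'.
have /eqP : 2 * pi * (q - (Num.floor q)%:~R) = 0.
  by apply: h'; rewrite mulrBr -mulrN -mulrNz expiD h mul1r expi_2pi_int.
by rewrite mulf_eq0 gt_eqF.
Qed.

Lemma expi_inj s t : 0 <= s < 2 * pi -> 0 <= t < 2 * pi -> expi s = expi t -> s = t.
Proof.
wlog st : s t / s <= t => [hw hs ht h|/andP[s0 s2] /andP[t0 t2] h].
  have [st|ts] := leP s t; first exact: hw.
  by apply/esym/hw => //; apply: ltW.
suff : t - s = 0 by lra.
apply: expi_eq1; first by apply/andP; split; lra.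
apply: (mulIf (expi_neq0 s)); rewrite -expiD mul1r h.
by congr expi; ring.
Qed.

(** The power [i.+1] is 1 only if [i.+1] is an integer multiple of [n]; as [i < n], that multiple is
    [n] itself. *)
Lemma expi_prim_root n : (0 < n)%N ->
  n.-primitive_root (expi (2 * pi * n%:R^-1 : R)).
Proof.
move=> n0; have expiX m t : expi t ^+ m = expi (t * m%:R).
  elim: m => [|m IH]; first by rewrite mulr0 expi0.
  by rewrite exprS IH -expiD -[m.+1]addn1 natrD mulrDr mulr1 addrC.
apply/andP; split=> //; apply/forallP => i; rewrite unity_rootE expiX -mulrA.
have nn : n%:R != 0 :> R by rewrite pnatr_eq0 -lt0n.
apply/eqP; apply/eqP/eqP => [/expi_2piP[k kE]|->]; last first.
  by rewrite mulVf // (expi_2pi_int 1).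
have : i.+1%:R = k%:~R * n%:R :> R by rewrite -kE mulrAC mulVf // mul1r.
rewrite !pmulrn -intrM => /eqP; rewrite eqr_int => /eqP kn.
have i_n := ltn_ord i.
have k1 : k = 1 by nia.
by move: kn; rewrite k1 mul1r => -[].
Qed.

End Expi.

(** Translating [x] to 0 brings the other two points into turn 0, where [clt0_cyc] applies. *)
Lemma cyc_uw_lt (K : cogroupType) (x y w : unwound K) :
  x < y -> y < w -> w < x + uw_z K -> cyc (uw_pt x) (uw_pt y) (uw_pt w).
Proof.
move=> xy yw wx.
have turn0 u : x <= u -> u < x + uw_z K -> uw_turn (u - x) = 0.
  move=> xu ux; apply/eqP; rewrite -uw_ltz leU_subr xu -ltU_subr.
  by rewrite (_ : _ - _ = x + uw_z K - u) ?ltU_subr //; zmod.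
have ty := turn0 y (ltW xy) (lt_trans yw wx).
have tw := turn0 w (ltW (lt_trans xy yw)) wx.
have := @clt0_cyc _ (uw_pt 0) (uw_pt (y - x)) (uw_pt (w - x)).
rewrite !clt0_ptE // ltU_subr xy -ltU_subr (_ : _ - _ = w - y); last by zmod.
rewrite ltU_subr yw => /(_ isT isT) /(cyc_add (uw_pt x)).
by rewrite -!uw_ptD add0r !subrK.
Qed.

Section CircleEmbedding.
Variables (R : realType) (K : cogroupType) (e : K).
Hypotheses (pK : presburger e)
  (K_torsion : forall x : K, exists n (k : int), (0 < n)%N /\ x *+ n = e *~ k).
Local Notation eps := (uw_lift e).
Local Notation z := (uw_z K).
Local Notation pi_K := (\pi_(co_quot K)).
Implicit Types (x y w : unwound K) (A B C : co_quot K).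

Definition is_slope x (q : R) : Prop := exists n (a b : int),
  [/\ (0 < n)%N, x *+ n = eps *~ a + z *~ b & q = b%:~R / n%:R].

(** The value exists by [is_slope_slope] and is unique by [slopeE]; the default 0 only makes the
    choice total. *)
Definition slope x : R := xget 0 (is_slope x).

Lemma is_slope_slope x : is_slope x (slope x).
Proof.
have [n [a [b [n0 xE]]]] := uw_torsion K_torsion x.
apply: (@xgetPex _ 0 (is_slope x)); exists (b%:~R / n%:R).
by exists n, a, b.
Qed.

Lemma slopeE x n (a b : int) : (0 < n)%N -> x *+ n = eps *~ a + z *~ b ->
  slope x = b%:~R / n%:R.
Proof.
move=> n0 xE; have [m [c [d [m0 xE' ->]]]] := is_slope_slope x.
have : eps *~ (a * m%:Z) + z *~ (b * m%:Z) = eps *~ (c * n%:Z) + z *~ (d * n%:Z).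
  have -> : eps *~ (a * m%:Z) + z *~ (b * m%:Z) = x *+ n *+ m by rewrite xE; zmod.
  have -> : eps *~ (c * n%:Z) + z *~ (d * n%:Z) = x *+ m *+ n by rewrite xE'; zmod.
  by rewrite -!mulrnA mulnC.
move/(eps_z_inj pK) => /(congr1 (fun k : int => k%:~R : R)).
rewrite !intrM => bd; apply/eqP; rewrite eqr_div ?pnatr_eq0 -?lt0n //.
by rewrite eq_sym; apply/eqP.
Qed.

Fact slope_additive : additive slope.
Proof.
move=> x y; have [n [a [b [n0 xE ->]]]] := is_slope_slope x.
have [m [c [d [m0 yE ->]]]] := is_slope_slope y.
rewrite (@slopeE (x - y) (n * m)%N (a * m%:Z - c * n%:Z) (b * m%:Z - d * n%:Z)).
- have nn : n%:R != 0 :> R by rewrite pnatr_eq0 -lt0n.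
  have mm : m%:R != 0 :> R by rewrite pnatr_eq0 -lt0n.
  rewrite intrB !intrM natrM; field.
  by rewrite nn mm.
- by rewrite muln_gt0 n0.
have -> : (x - y) *+ (n * m) = x *+ n *+ m - y *+ m *+ n by zmod.
by rewrite xE yE; zmod.
Qed.

HB.instance Definition _ :=
  GRing.isZmodMorphism.Build (unwound K) R slope slope_additive.

Lemma slope_z : slope z = 1.
Proof.
by rewrite (@slopeE _ 1 0 1) // ?divr1 // mulr0z add0r.
Qed.

(** Only strict positivity of the slope is conclusive: all multiples of [eps] have slope 0. *)
Lemma slope_gt0 x : 0 < slope x -> 0 < x.
Proof.
have [n [a [b [n0 xE ->]]]] := is_slope_slope x.
rewrite pmulr_lgt0 ?invr_gt0 ?ltr0n // ltr0z => b0.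
rewrite -(ltU_pMz2r _ _ (_ : 0 < n%:Z)); last by lia.
by rewrite mul0rz -pmulrn xE eps_z_gt0.
Qed.

Lemma slope_eq0 x : slope x = 0 <-> max_convex x.
Proof.
split=> [|/(max_convex_eps pK K_torsion)[k ->]]; last first.
  by rewrite (@slopeE _ 1 k 0) ?mul0r // mulr0z addr0.
have [n [a [b [n0 xE ->]]]] := is_slope_slope x.
move/eqP; rewrite mulf_eq0 invr_eq0 pnatr_eq0 -leqn0 leqNgt n0 orbF intr_eq0.
move=> /eqP b0; apply/(max_convex_eps pK K_torsion).
by apply: (mulUn_eps pK n0 (a := a)); rewrite xE b0 mulr0z addr0.
Qed.

Definition winding x : R[i] := expi (2 * pi * slope x).

Lemma windingD x y : winding (x + y) = winding x * winding y.
Proof. by rewrite /winding raddfD mulrDr expiD. Qed.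

(** An integral slope [k] means that [x - z *~ k] has slope 0, hence lies in [max_convex]. *)
Lemma winding_eq1 x : winding x = 1 <-> uw_pt x \in lin_part K.
Proof.
split=> [/expi_2piP[k xk]|/lin_partP[y /slope_eq0 y0 /esym/uw_eqz->]].
  apply/lin_partP; exists (x - z *~ k).
    by apply/slope_eq0; rewrite raddfB raddfMz /= slope_z xk subrr.
  by rewrite uw_ptD uw_ptN uw_ptz subr0.
apply/expi_2piP; exists (uw_turn x - uw_turn y).
by rewrite raddfD raddfMz /= slope_z y0 add0r.
Qed.

Lemma winding_eq x y :
  winding x = winding y <-> pi_K (uw_pt x) = pi_K (uw_pt y).
Proof.
have -> : winding x = winding y <-> winding (x - y) = 1.
  have -> : winding x = winding (x - y) * winding y by rewrite -windingD subrK.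
  split=> [|->]; last by rewrite mul1r.
  by rewrite -[X in _ = X]mul1r => /(mulIf (expi_neq0 _)).
rewrite winding_eq1 uw_ptD uw_ptN -co_quot_eqE.
by split=> /eqP.
Qed.

(** A lift between [0] and [z] may have slope 1, as [z - eps] does. Subtracting the floor brings the
    slope below 1. *)
Definition quot_lift A : unwound K :=
  let x := uw_lift (repr A) in x - z *~ Num.floor (slope x).

Lemma quot_liftK A : pi_K (uw_pt (quot_lift A)) = A.
Proof. by rewrite uw_ptD uw_ptN uw_ptz subr0 reprK. Qed.

Lemma slope_quot_lift A : 0 <= slope (quot_lift A) < 1.
Proof.
rewrite /quot_lift raddfB raddfMz /= slope_z.
have /andP[f1 f2] := floor_itv (slope (uw_lift (repr A))).
by rewrite subr_ge0 f1 ltrBlDl -(intrD _ _ 1).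
Qed.

(** Increasing slopes give increasing lifts, and slopes in [[0, 1)] keep the three lifts within one
    turn. *)
Lemma quot_lift_cyc A B C :
  slope (quot_lift A) < slope (quot_lift B) ->
  slope (quot_lift B) < slope (quot_lift C) -> cyc A B C.
Proof.
move=> AB BC; have /andP[A0 _] := slope_quot_lift A.
have /andP[_ C1] := slope_quot_lift C.
have slope_lt x y : slope x < slope y -> x < y.
  by move=> xy; rewrite -ltU_subr; apply: slope_gt0; rewrite raddfB subr_gt0.
have hAB := slope_lt _ _ AB; have hBC := slope_lt _ _ BC.
have hCA : quot_lift C < quot_lift A + z.
  by apply: slope_lt; rewrite (raddfD _ (quot_lift A)) /= slope_z; lra.
have ABn : A != B by apply: contraTneq AB => ->; rewrite ltxx.
have BCn : B != C by apply: contraTneq BC => ->; rewrite ltxx.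
have ACn : A != C by apply: contraTneq (lt_trans AB BC) => ->; rewrite ltxx.
rewrite -(quot_liftK A) -(quot_liftK B) -(quot_liftK C).
by rewrite co_quot_cycE ?quot_liftK // cyc_uw_lt.
Qed.

Lemma slope_quot_lift_inj A B :
  slope (quot_lift A) = slope (quot_lift B) -> A = B.
Proof.
move=> AB; rewrite -(quot_liftK A) -(quot_liftK B); apply/winding_eq.
by rewrite /winding AB.
Qed.

Definition quot_circle A : R[i] := winding (quot_lift A).

Let angle A : R := 2 * pi * slope (quot_lift A).

Let angle_itv A : 0 <= angle A < 2 * pi.
Proof.
have p2 : 0 < 2 * pi :> R by rewrite mulr_gt0 ?pi_gt0.
have /andP[s0 s1] := slope_quot_lift A.
by rewrite /angle pmulr_rge0 // s0 -[X in _ < X]mulr1 ltr_pM2l.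
Qed.

Let angle_lt A B : (angle A < angle B) = (slope (quot_lift A) < slope (quot_lift B)).
Proof. by rewrite ltr_pM2l // mulr_gt0 ?pi_gt0. Qed.

Let angle_cyc A B C :
  [\/ angle A < angle B < angle C, angle B < angle C < angle A |
      angle C < angle A < angle B] -> cyc A B C.
Proof.
rewrite !angle_lt; case=> /andP[h1 h2]; first exact: quot_lift_cyc.
  by do 2!apply: cyc_rot; apply: quot_lift_cyc.
by apply: cyc_rot; apply: quot_lift_cyc.
Qed.

Let angle_neq A B : A != B -> angle A != angle B.
Proof.
apply: contraNneq => AB; apply/eqP/slope_quot_lift_inj.
by apply: (mulfI _ AB); rewrite gt_eqF // mulr_gt0 ?pi_gt0.
Qed.

Lemma quot_circle_cyc A B C :
  cyc A B C <-> circle_cyc (quot_circle A) (quot_circle B) (quot_circle C).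
Proof.
split=> [ABC|[t1 [t2 [t3 [[h1 h2 h3] [e1 e2 e3] h]]]]]; last first.
  apply: angle_cyc.
  rewrite -(expi_inj (angle_itv A) h1 e1 : angle A = t1) in h.
  rewrite -(expi_inj (angle_itv B) h2 e2 : angle B = t2) in h.
  by rewrite -(expi_inj (angle_itv C) h3 e3 : angle C = t3) in h.
exists (angle A), (angle B), (angle C); split=> //.
have [AB BC AC] := cyc_neq ABC.
have nACB := cyc_asym ABC.
(* The three angles are distinct, so they have six possible orders; three of them would give
   [cyc A C B]. *)
have nang : ~ [\/ angle A < angle C < angle B, angle C < angle B < angle A |
      angle B < angle A < angle C].
  by move/angle_cyc; rewrite nACB.
have := angle_neq AB; have := angle_neq BC; have := angle_neq AC.
move: nang; move: (angle A) (angle B) (angle C) => a b c nang ac bc ab.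
have [a_b|b_a|abE] := ltgtP a b; last by rewrite abE eqxx in ab.
  have [b_c|c_b|bcE] := ltgtP b c; last by rewrite bcE eqxx in bc.
    by constructor 1.
  have [a_c|c_a|acE] := ltgtP a c; last by rewrite acE eqxx in ac.
    by case: nang; constructor 1; rewrite a_c c_b.
  by constructor 3.
have [b_c|c_b|bcE] := ltgtP b c; last by rewrite bcE eqxx in bc.
  have [a_c|c_a|acE] := ltgtP a c; last by rewrite acE eqxx in ac.
    by case: nang; constructor 3; rewrite b_a a_c.
  by constructor 2.
by case: nang; constructor 2; rewrite c_b b_a.
Qed.

Lemma quot_circle_embedding : circle_embedding quot_circle.
Proof.
split=> [A|A B|A B|]; last exact: quot_circle_cyc.
- exact: circle_expi.
- by move/winding_eq; rewrite !quot_liftK.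
rewrite -windingD; apply/winding_eq.
by rewrite uw_ptD raddfD /= !quot_liftK.
Qed.

Lemma windingMn x n : winding (x *+ n) = winding x ^+ n.
Proof.
elim: n => [|n IH]; first by rewrite mulr0n /winding raddf0 mulr0 expi0.
by rewrite mulrS exprS windingD IH.
Qed.

Lemma quot_circle_image : circle_image (co_quot K) (roots_of_unity R).
Proof.
exists quot_circle; first exact: quot_circle_embedding.
apply/seteqP; split=> [_ [A _ <-]|w [n n0 wn]].
  have [n [k [n0 Ak]]] := K_torsion (uw_pt (quot_lift A)).
  exists n => //; rewrite /quot_circle -windingMn; apply/winding_eq1.
  apply/lin_partP; exists (eps *~ k); last by rewrite uw_ptMn uw_ptMz.
  by apply/(max_convex_eps pK K_torsion); exists k.
have [i wE] := prim_rootP (expi_prim_root R n0) wn.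
(* Since [y *+ n] is [z] up to a multiple of [eps], [y] has slope [1 / n] and its winding is the
   chosen primitive root. *)
have [y [r zE]] := pres_div pK z n0.
exists (pi_K (uw_pt (y *+ i))) => //.
have -> : quot_circle (pi_K (uw_pt (y *+ i))) = winding (y *+ i).
  by apply/winding_eq; rewrite quot_liftK.
rewrite windingMn wE /winding (@slopeE y n (- r) 1) ?div1r //.
by rewrite [in RHS]zE; zmod.
Qed.

End CircleEmbedding.

Theorem proposition4p15 (R : realType) (G : cogroupType)
    (G_regular : c_regular G) (G_discrete : discrete_co G)
    (G_narch : ~ c_archimedean G) :
  exists H : zmodClosed G,
    [/\ pure_subgroup H,
        discrete_co (subco H) /\ c_regular (subco H),
        circle_image (co_quot (subco H)) (roots_of_unity R),
        lin_part_isoZ (subco H) &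
        elementary_subgroup H].
Proof.
(* Discreteness admits the trivial group, but that group is c-archimedean. *)
have [e e0 e_min] : exists2 e : G, e != 0 &
    forall x : G, x != 0 -> x = e \/ cyc 0 e x.
  by case: G_discrete => // G0; case: G_narch => a _; apply: G0.
have pG : presburger e.
  by apply: regular_presburger => //; apply: lin_part_unit_inf.
have pH := hull_presburger pG; have tH := @hull_torsion _ e.
exists (pure_hull e : zmodClosed G); split.
- exact: pure_hull_pure.
- by split; [apply: hull_discrete|apply: presburger_regular pH].
- exact: quot_circle_image pH tH.
- exact: presburger_lin_part_isoZ pH tH.
- exact: hull_elementary.
Qed.
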